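(* Let $1 \le p < \infty$, let $L^p([0,1])$ denote the (complex) Lebesgue space on $[0,1]$ with Lebesgue measure $\lambda$, and let $T \in \mathcal{B}(L^p([0,1]))$ be a narrow operator. Then for every $\gamma \in \mathbb{C}$, $$\|I - T\|_{L^p \to L^p} + \inf_{\|u\|_{L^p} = 1} \|(\gamma I - T)u\|_{L^p} \ge \|I - \gamma \mathbf{E}\|_{L^p \to L^p},$$ and in particular $$\|I - T\|_{L^p \to L^p} + \inf_{\|u\|_{L^p} = 1} \|(I - T)u\|_{L^p} \ge C_p .$$
   Context: $\mathcal{B}(X)$ denotes the bounded linear operators on a Banach space $X$ and $I$ the identity operator. $\mathbf{E}$ is the operator $\mathbf{E}f := \left(\int_0^1 f\,d\lambda\right)\mathbf{1}$, where $\mathbf{1}$ is the constant function $1$ on $[0,1]$. A measurable function $g$ is a sign on a measurable set $A$ if $g$ takes values in $\{-1,0,1\}$ and $g^2 = \mathbb{I}_A$ (indicator of $A$); it is of mean zero if $\int g\,d\lambda = 0$. An operator $T \in \mathcal{B}(L^p([0,1]), Y)$ ($Y$ a Banach space) is narrow if for every measurable $A$ with $\lambda(A) > 0$ and every $\varepsilon > 0$ there exists a mean zero sign $g$ on $A$ with $\|Tg\| < \varepsilon$. The constant $C_p$ is defined by $C_1 := 2$ and, for $1 < p < \infty$, $$C_p := \max_{0 \le \alpha \le 1} \left(\alpha^{p-1} + (1-\alpha)^{p-1}\right)^{\frac1p} \left(\alpha^{\frac{1}{p-1}} + (1-\alpha)^{\frac{1}{p-1}}\right)^{1-\frac1p}.$$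 *)

(* Defs.v *)
From mathcomp Require Import all_boot all_order all_algebra.
From mathcomp.real_closed Require Import complex.
From mathcomp Require Import all_classical all_reals all_analysis.

Set Implicit Arguments.
Unset Strict Implicit.
Unset Printing Implicit Defensive.
Import Order.TTheory GRing.Theory Num.Theory.
Import numFieldNormedType.Exports.
Local Open Scope classical_set_scope.
Local Open Scope ring_scope.

(* Complex scalars: C := R[i] for R : realType.  Elements of L^p([0,1]) are
   represented by functions R -> R[i]; only their values on [0,1] matter
   (all notions below only look at [0,1], and equalities are a.e. on [0,1]). *)

Section Lp01.
Variable R : realType.
Local Notation C := (R[i]).
Local Notation lam := (@lebesgue_measure R).
Local Notation I01 := ([set` `[0%R, 1%R]] : set R).

Definition cabs (z : C) : R := complex.Re `|z|.

Definition Lpnorm (p : R) (f : R -> C) : \bar R :=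
  Lnorm lam p%:E (fun x => (\1_I01 x * cabs (f x))%:E).

Definition cmeasurable (f : R -> C) : Prop :=
  measurable_fun I01 (fun x => complex.Re (f x)) /\ measurable_fun I01 (fun x => complex.Im (f x)).

Definition inLp (p : R) (f : R -> C) : Prop :=
  cmeasurable f /\ (Lpnorm p f < +oo)%E.

Definition ae01 (f g : R -> C) : Prop :=
  {ae lam, forall x, I01 x -> f x = g x}.

(* bounded linear operators on L^p([0,1]), acting on representatives:
   they preserve L^p, respect a.e. equality, are linear (a.e.) and bounded. *)
Definition bounded_op (p : R) (T : (R -> C) -> (R -> C)) : Prop :=
  [/\ (forall f, inLp p f -> inLp p (T f)),
      (forall f g, inLp p f -> inLp p g -> ae01 f g -> ae01 (T f) (T g)),
      (forall (a : C) f g, inLp p f -> inLp p g ->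
          ae01 (T (fun x => a * f x + g x)) (fun x => a * T f x + T g x)) &
      (exists M : R, forall f, inLp p f -> (Lpnorm p (T f) <= M%:E * Lpnorm p f)%E)].

Definition opnorm (p : R) (S : (R -> C) -> (R -> C)) : \bar R :=
  ereal_sup [set Lpnorm p (S f) | f in [set f | inLp p f /\ (Lpnorm p f <= 1)%E]].

Definition lower_bound (p : R) (S : (R -> C) -> (R -> C)) : \bar R :=
  ereal_inf [set Lpnorm p (S u) | u in [set u | inLp p u /\ Lpnorm p u = 1%E]].

Definition cint01 (f : R -> C) : C :=
  complex.Complex (fine (\int[lam]_(x in I01) (complex.Re (f x))%:E))
                  (fine (\int[lam]_(x in I01) (complex.Im (f x))%:E)).

Definition Eop (f : R -> C) : R -> C := fun _ => cint01 f.

Definition Iop (f : R -> C) : R -> C := f.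
Definition op_sub (S1 S2 : (R -> C) -> (R -> C)) : (R -> C) -> (R -> C) :=
  fun f x => S1 f x - S2 f x.
Definition op_scale (a : C) (S : (R -> C) -> (R -> C)) : (R -> C) -> (R -> C) :=
  fun f x => a * S f x.

Definition is_sign (A : set R) (g : R -> R) : Prop :=
  measurable_fun setT g /\
  (forall x, g x = -1 \/ g x = 0 \/ g x = 1) /\
  (forall x, g x ^+ 2 = \1_A x).

Definition mean_zero (g : R -> R) : Prop :=
  (\int[lam]_(x in I01) (g x)%:E = 0)%E.

Definition narrow (p : R) (T : (R -> C) -> (R -> C)) : Prop :=
  forall (A : set R), measurable A -> A `<=` I01 -> (0 < lam A)%E ->
  forall eps : R, 0 < eps ->
  exists g : R -> R, is_sign A g /\ mean_zero g /\
    (Lpnorm p (T (fun x => complex.Complex (g x) 0%R)) < eps%:E)%E.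

Definition Cp (p : R) : R :=
  if p == 1 then 2 else
  sup [set ((a `^ (p - 1) + (1 - a) `^ (p - 1)) `^ p^-1 *
            (a `^ (p - 1)^-1 + (1 - a) `^ (p - 1)^-1) `^ (1 - p^-1))%R
      | a in [set` `[0%R, 1%R]]].

End Lp01.

(* Main.v *)
(* Let u be a unit vector and f a vector in the unit ball, both approximated by
   simple functions u = sum_i a_i 1_(A_i) and f = sum_j c_j 1_(D_j), where the D_j
   partition [0,1].  A narrow operator splits every set in halves, hence in any
   prescribed proportions, up to a small error under T: there are disjoint
   B_(i,j) in A_i of measure |A_i| |D_j| with T 1_(B_(i,j)) close to |D_j| T 1_(A_i).
   Then w = sum_(i,j) a_i c_j 1_(B_(i,j)) behaves like a tensor product u * f: its
   norm is |u| |f|, and T w is close to m T u with m = int f.  Since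
     w - gamma m u = (w - T w) - m (gamma u - T u) + (T w - m T u)
   and the left-hand side dominates the tensor product of u and f - gamma m, one gets
     |f - gamma m| <= |I - T| + |(gamma I - T) u|.
   The constant C_p is bounded by testing I - E on functions with two values. *)

Require Import Defs.
From mathcomp Require Import all_boot all_order all_algebra.
From mathcomp.real_closed Require Import complex.
From mathcomp Require Import finmap.
From mathcomp Require Import all_classical all_reals all_analysis.
From mathcomp Require Import measurable_realfun measurable_fun_approximation.
From mathcomp Require Import ring lra.
Import Order.TTheory GRing.Theory Num.Theory.
Import numFieldNormedType.Exports.
Set Implicit Arguments.
Unset Strict Implicit.
Unset Printing Implicit Defensive.
Local Open Scope classical_set_scope.
Local Open Scope ring_scope.

(** * The norm of L^p([0,1]) *)

(** Narrowness controls T on a single mean zero sign, so by itself it only halves a set. A ratio t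
    is reached through halves of halves; this need not end for non-dyadic t, and the last remainder
    is made so small that boundedness of T suffices there. Measures stay exact throughout and only
    images under T carry an error, so the norm identities for tensor products hold without error
    terms. The errors get multiplied by the coefficients a_i c_j, and a finite sum of these is what
    makes them controllable: hence simple functions. Approximating u and f from below in modulus
    keeps both in the unit ball, at the price of a norm of u slightly below 1. The factor m is
    harmless because |m| <= |f| on a probability space. The tensor product is dominated rather than
    equal pointwise, because the B_(i,j) exhaust A_i only up to a null set. *)

Section cabs.
Variable R : realType.
Implicit Types z w : R[i].

Lemma cabsE z : (cabs z)%:C%C = `|z|.
Proof. by rewrite /cabs normc_def. Qed.

Lemma cabs_sqrt z : cabs z = Num.sqrt (complex.Re z ^+ 2 + complex.Im z ^+ 2).
Proof. by rewrite /cabs normc_def. Qed.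

Lemma cabs_ge0 z : 0 <= cabs z.
Proof. by rewrite cabs_sqrt sqrtr_ge0. Qed.

Lemma cabsM z w : cabs (z * w) = cabs z * cabs w.
Proof. by apply: complexI; rewrite cabsE normrM rmorphM /= !cabsE. Qed.

Lemma ler_cabsD z w : cabs (z + w) <= cabs z + cabs w.
Proof. by rewrite -lecR rmorphD /= !cabsE ler_normD. Qed.

Lemma cabs0 : cabs (0 : R[i]) = 0.
Proof. by apply: complexI; rewrite cabsE normr0. Qed.

Lemma cabs1 : cabs (1 : R[i]) = 1.
Proof. by apply: complexI; rewrite cabsE normr1. Qed.

Lemma cabsN z : cabs (- z) = cabs z.
Proof. by apply: complexI; rewrite !cabsE normrN. Qed.

Lemma cabs_real (x : R) : cabs (x%:C)%C = `|x|.
Proof. by rewrite cabs_sqrt /= expr0n addr0 sqrtr_sqr. Qed.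

Lemma cabs_nat n : cabs (n%:R : R[i]) = n%:R.
Proof. by apply: complexI; rewrite cabsE normr_nat rmorph_nat. Qed.

Lemma ler_Re_cabs z : `|complex.Re z| <= cabs z.
Proof. by rewrite cabs_sqrt -sqrtr_sqr ler_wsqrtr// lerDl sqr_ge0. Qed.

Lemma ler_Im_cabs z : `|complex.Im z| <= cabs z.
Proof. by rewrite cabs_sqrt -sqrtr_sqr ler_wsqrtr// lerDr sqr_ge0. Qed.

Lemma ler_cabs_ReIm z w : `|complex.Re z| <= `|complex.Re w| ->
  `|complex.Im z| <= `|complex.Im w| -> cabs z <= cabs w.
Proof.
by move=> h1 h2; rewrite !cabs_sqrt ler_wsqrtr// lerD// -ler_sqrt ?sqr_ge0// !sqrtr_sqr.
Qed.

Lemma cabs_le_ReIm z : cabs z <= `|complex.Re z| + `|complex.Im z|.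
Proof.
rewrite cabs_sqrt -(@ler_pXn2r _ 2) ?nnegrE ?sqrtr_ge0 ?addr_ge0//.
rewrite sqr_sqrtr ?addr_ge0 ?sqr_ge0// -(real_normK (num_real (complex.Re z))).
rewrite -(real_normK (num_real (complex.Im z))).
have := normr_ge0 (complex.Re z); have := normr_ge0 (complex.Im z); nra.
Qed.

Lemma cabs_sum (I : Type) (s : seq I) (F : I -> R[i]) :
  cabs (\sum_(i <- s) F i) <= \sum_(i <- s) cabs (F i).
Proof.
elim/big_ind2: _ => //; first by rewrite cabs0.
by move=> x1 x2 y1 y2 h1 h2; rewrite (le_trans (ler_cabsD _ _))// lerD.
Qed.

End cabs.

Section Lp.
Variable R : realType.
Local Notation C := (R[i]).
Local Notation lam := (@lebesgue_measure R).
Local Notation I01 := ([set` `[0%R, 1%R]] : set R).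
Variable p : R.
Hypothesis p1 : 1 <= p.
Implicit Types f g h : R -> C.

Let p0 : 0 < p. Proof. exact: lt_le_trans ltr01 p1. Qed.
Let p_neq0 : p != 0. Proof. by rewrite gt_eqF. Qed.

(** A real function vanishing off [0,1]: integrals run over the whole line, and Minkowski's
    inequality for real functions applies. *)
Definition absf f x : R := \1_I01 x * cabs (f x).

(** The p-th power of the norm, which is additive over disjoint pieces. *)
Definition Lpint f : \bar R := (\int[lam]_x (absf f x `^ p)%:E)%E.

Lemma absf_ge0 f x : 0 <= absf f x.
Proof. by rewrite mulr_ge0// cabs_ge0. Qed.

Lemma absf_in f x : I01 x -> absf f x = cabs (f x).
Proof. by move=> Ix; rewrite /absf indicE mem_set// mul1r. Qed.

Lemma absf_out f x : ~ I01 x -> absf f x = 0.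
Proof. by move=> Ix; rewrite /absf indicE memNset// mul0r. Qed.

Lemma Lpint_ge0 f : (0 <= Lpint f)%E.
Proof. by apply: integral_ge0 => x _; rewrite lee_fin powR_ge0. Qed.

Lemma LpnormE f : Lpnorm p f = (Lpint f `^ p^-1)%E.
Proof.
rewrite /Lpnorm unlock (_ : integral _ _ _ = Lpint f)//.
by apply: eq_integral => x _; rewrite /= ger0_norm ?absf_ge0.
Qed.

Lemma Lpnorm_ge0 f : (0 <= Lpnorm p f)%E.
Proof. exact: Lnorm_ge0. Qed.

Lemma Lpint_Lpnorm f : (Lpnorm p f `^ p)%E = Lpint f.
Proof. by rewrite LpnormE -poweRrM mulVf// poweRe1// Lpint_ge0. Qed.

Lemma measurable_absf f : cmeasurable f -> measurable_fun setT (absf f).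
Proof.
move=> [mRe mIm].
have -> : absf f = (fun x => cabs (f x)) \_ I01.
  by apply/funext => x; rewrite /absf patchE indicE; case: ifP; rewrite ?mul1r ?mul0r.
apply/(measurable_restrictT _ _).1 => //=.
rewrite (_ : (fun x => cabs (f x)) =
  (fun x => Num.sqrt (complex.Re (f x) ^+ 2 + complex.Im (f x) ^+ 2))); last first.
  by apply/funext => x; rewrite cabs_sqrt.
apply: (@measurableT_comp _ _ _ _ _ _ (@Num.sqrt R)).
  apply: continuous_measurable_fun; exact: sqrt_continuous.
apply: measurable_funD; exact: measurable_funX.
Qed.

Lemma measurable_absfp f : cmeasurable f ->
  measurable_fun setT (fun x => (absf f x `^ p)%:E).
Proof.
move=> mf; apply/measurable_EFinP.
by apply: (@measurableT_comp _ _ _ _ _ _ (@powR R ^~ p)) => //; exact: measurable_absf.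
Qed.

Lemma cmeasurableD f g : cmeasurable f -> cmeasurable g ->
  cmeasurable (fun x => f x + g x).
Proof.
move=> [f1 f2] [g1 g2]; split.
  rewrite (_ : (fun _ => _) = (fun x => complex.Re (f x) + complex.Re (g x))).
    exact: measurable_funD.
  by apply/funext => x; case: (f x) (g x) => ? ? [].
rewrite (_ : (fun _ => _) = (fun x => complex.Im (f x) + complex.Im (g x))).
  exact: measurable_funD.
by apply/funext => x; case: (f x) (g x) => ? ? [].
Qed.

Lemma cmeasurableZ a f : cmeasurable f -> cmeasurable (fun x => a * f x).
Proof.
move=> [f1 f2]; case: a => a b; split.
  rewrite (_ : (fun _ => _) = (fun x => a * complex.Re (f x) - b * complex.Im (f x))).
    by apply: measurable_funB; exact: measurable_funM.
  by apply/funext => x; case: (f x).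
rewrite (_ : (fun _ => _) = (fun x => a * complex.Im (f x) + b * complex.Re (f x))).
  by apply: measurable_funD; exact: measurable_funM.
by apply/funext => x; case: (f x).
Qed.

Lemma cmeasurable_cst (a : C) : cmeasurable (fun _ : R => a).
Proof. by split; exact: measurable_cst. Qed.

Lemma le_Lpint f g : cmeasurable g ->
  (forall x, I01 x -> cabs (f x) <= cabs (g x)) -> cmeasurable f -> (Lpint f <= Lpint g)%E.
Proof.
move=> mg fg mf; apply: ge0_le_integral => //.
- by move=> x _; rewrite lee_fin powR_ge0.
- exact: measurable_absfp.
- exact: measurable_absfp.
move=> x _; rewrite lee_fin ge0_ler_powR ?nnegrE ?absf_ge0 ?(ltW p0)//.
rewrite /absf indicE; case: (boolP (x \in _)) => [|_]; last by rewrite !mul0r.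
by rewrite inE !mul1r => /fg.
Qed.

Lemma le_Lpnorm f g : cmeasurable f -> cmeasurable g ->
  (forall x, I01 x -> cabs (f x) <= cabs (g x)) -> (Lpnorm p f <= Lpnorm p g)%E.
Proof.
move=> mf mg fg; rewrite !LpnormE; apply: gt0_ler_poweR.
- by rewrite invr_ge0 ltW.
- by rewrite in_itv/= leey Lpint_ge0.
- by rewrite in_itv/= leey Lpint_ge0.
exact: le_Lpint.
Qed.

Lemma ae_Lpnorm f g : cmeasurable f -> cmeasurable g -> ae01 f g ->
  Lpnorm p f = Lpnorm p g.
Proof.
move=> mf mg fg; rewrite !LpnormE (_ : Lpint f = Lpint g)//.
apply: ae_eq_integral => //.
- exact: measurable_absfp.
- exact: measurable_absfp.
apply: (@filterS _ _ (ae_filter_ringOfSetsType lam) _ _ _ fg) => x /= {}fg _.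
congr (_ `^ _)%:E; have [Ix|Ix] := pselect (I01 x); last by rewrite !absf_out.
by rewrite !absf_in// fg.
Qed.

Lemma Lpnorm_scale a f : cmeasurable f ->
  Lpnorm p (fun x => a * f x) = ((cabs a)%:E * Lpnorm p f)%E.
Proof.
move=> mf.
(* |a| is written as (|a|^p)^(1/p), so that it can move under the root. *)
rewrite !LpnormE -[in RHS](@powRr1 _ (cabs a)) ?cabs_ge0// -(mulfV p_neq0) powRrM.
rewrite -poweR_EFin -poweRM ?lee_fin ?powR_ge0 ?Lpint_ge0//; congr (_ `^ _)%E.
rewrite /Lpint -ge0_integralZl_EFin ?powR_ge0//.
- apply: eq_integral => x _; rewrite -EFinM -powRM ?cabs_ge0 ?absf_ge0//.
  by rewrite /absf cabsM mulrCA.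
- by move=> x _; rewrite lee_fin powR_ge0.
- exact: measurable_absfp.
Qed.

Lemma Lpnorm_triangle f g : cmeasurable f -> cmeasurable g ->
  (Lpnorm p (fun x => (f x + g x)%R) <= Lpnorm p f + Lpnorm p g)%E.
Proof.
move=> mf mg.
have := @minkowski_EFin _ _ _ lam _ _ _ (measurable_absf mf) (measurable_absf mg) p1.
apply: le_trans.
rewrite LpnormE unlock; apply: gt0_ler_poweR.
- by rewrite invr_ge0 ltW.
- by rewrite in_itv/= leey Lpint_ge0.
- by rewrite in_itv/= leey integral_ge0.
apply: ge0_le_integral => //.
- by move=> x _; rewrite lee_fin powR_ge0.
- by apply: measurable_absfp; exact: cmeasurableD.
- apply/measurable_EFinP.
  apply: (@measurableT_comp _ _ _ _ _ _ (@powR R ^~ p)) => //.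
  by apply: measurableT_comp => //; apply: measurable_funD; exact: measurable_absf.
move=> x _; rewrite /= lee_fin ge0_ler_powR ?nnegrE ?absf_ge0 ?(ltW p0)//.
rewrite ger0_norm ?addr_ge0 ?absf_ge0// /absf -mulrDr ler_wpM2l//.
exact: ler_cabsD.
Qed.

Lemma inLpD f g : inLp p f -> inLp p g -> inLp p (fun x => f x + g x).
Proof.
move=> [mf fy] [mg gy]; split; first exact: cmeasurableD.
by apply: le_lt_trans (Lpnorm_triangle mf mg) _; exact: lte_add_pinfty.
Qed.

Lemma inLpZ a f : inLp p f -> inLp p (fun x => a * f x).
Proof.
move=> [mf fy]; split; first exact: cmeasurableZ.
by rewrite Lpnorm_scale// lte_mul_pinfty// lee_fin cabs_ge0.
Qed.

Lemma inLpB f g : inLp p f -> inLp p g -> inLp p (fun x => f x - g x).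
Proof.
move=> Lf /(@inLpZ (-1)) /(inLpD Lf).
by under eq_fun do rewrite mulN1r.
Qed.

Lemma inLp_le f g : cmeasurable f -> inLp p g ->
  (forall x, I01 x -> cabs (f x) <= cabs (g x)) -> inLp p f.
Proof.
by move=> mf [mg gy] fg; split => //; apply: le_lt_trans (le_Lpnorm mf mg fg) gy.
Qed.

(** Real-valued, for ordinary arithmetic. It stands for the norm only under [inLp], since [fine]
    sends +oo to 0. *)
Definition nrm f : R := fine (Lpnorm p f).

Lemma nrmE f : inLp p f -> Lpnorm p f = (nrm f)%:E.
Proof. by move=> [_ fy]; rewrite fineK// ge0_fin_numE// Lpnorm_ge0. Qed.

Lemma nrm_ge0 f : 0 <= nrm f.
Proof. by rewrite fine_ge0// Lpnorm_ge0. Qed.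

Lemma nrm_le f g : inLp p f -> inLp p g ->
  (forall x, I01 x -> cabs (f x) <= cabs (g x)) -> nrm f <= nrm g.
Proof.
by move=> Lf Lg fg; rewrite -lee_fin -!nrmE//; exact: (le_Lpnorm Lf.1 Lg.1 fg).
Qed.

Lemma nrm_ae f g : inLp p f -> inLp p g -> ae01 f g -> nrm f = nrm g.
Proof. by move=> [mf _] [mg _] fg; rewrite /nrm (ae_Lpnorm mf mg fg). Qed.

Lemma nrmZ a f : inLp p f -> nrm (fun x => a * f x) = cabs a * nrm f.
Proof.
by move=> Lf; apply: EFin_inj; rewrite EFinM -!nrmE//; [exact: Lpnorm_scale Lf.1|exact: inLpZ].
Qed.

Lemma nrmD f g : inLp p f -> inLp p g -> nrm (fun x => f x + g x) <= nrm f + nrm g.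
Proof.
move=> Lf Lg; rewrite -lee_fin EFinD -!nrmE//; last exact: inLpD.
exact: (Lpnorm_triangle Lf.1 Lg.1).
Qed.

Lemma nrmB f g : inLp p f -> inLp p g -> nrm (fun x => f x - g x) <= nrm f + nrm g.
Proof.
move=> Lf Lg; have := nrmD Lf (inLpZ (-1) Lg).
by rewrite nrmZ// cabsN cabs1 mul1r; under eq_fun do rewrite mulN1r.
Qed.

Lemma inLp_bounded f (M : R) : cmeasurable f -> (forall x, I01 x -> cabs (f x) <= M) -> inLp p f.
Proof.
move=> mf fM; split=> //; rewrite LpnormE poweR_lty//.
apply: (@le_lt_trans _ _ (\int[lam]_(x in I01) (cst (`|M| `^ p)%:E) x)%E).
  rewrite [leRHS]integral_mkcond; apply: ge0_le_integral => //.
  - by move=> x _; rewrite lee_fin powR_ge0.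
  - exact: measurable_absfp.
  - by apply/(measurable_restrictT _ _).1 => //=; exact: measurable_cst.
  move=> x _; rewrite patchE; case: ifPn => [|] xI.
    rewrite lee_fin ge0_ler_powR ?nnegrE ?absf_ge0 ?(ltW p0)//.
    by rewrite inE in xI; rewrite absf_in// (le_trans (fM _ xI)) ?ler_norm.
  by rewrite absf_out ?powR0// => xI'; rewrite mem_set in xI.
rewrite integral_cst//= lebesgue_measure_itv/= lte_fin ltr01.
by rewrite -EFinD -EFinM ltry.
Qed.

End Lp.

(** * Simple functions *)

Section simple.
Variable R : realType.
Local Notation C := (R[i]).
Local Notation lam := (@lebesgue_measure R).
Local Notation I01 := ([set` `[0%R, 1%R]] : set R).

Definition mu01 (A : set R) : R := fine (lam A).

Lemma lam_I01 : lam I01 = 1%E.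
Proof. by rewrite lebesgue_measure_itv/= lte_fin ltr01 oppr0 adde0. Qed.

Lemma le_lam_I01 (A : set R) : measurable A -> A `<=` I01 -> (lam A <= 1)%E.
Proof. by move=> mA AI; rewrite -lam_I01 le_measure ?inE//; exact: measurable_itv. Qed.

Lemma mu01E (A : set R) : measurable A -> A `<=` I01 -> lam A = (mu01 A)%:E.
Proof.
move=> mA AI; rewrite fineK// ge0_fin_numE//.
by apply: le_lt_trans (le_lam_I01 mA AI) (ltry _).
Qed.

Lemma mu01_ge0 (A : set R) : 0 <= mu01 A.
Proof. by rewrite fine_ge0. Qed.

Lemma mu01_le1 (A : set R) : measurable A -> A `<=` I01 -> mu01 A <= 1.
Proof. by move=> mA AI; rewrite -lee_fin -mu01E// le_lam_I01. Qed.

(** In this form a point determines its index, so a sum over the family collapses to one term. *)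
Definition disjointed (I : Type) (A : I -> set R) :=
  forall i j x, A i x -> A j x -> i = j.

Lemma sum_indic_in (K : pzRingType) (I : finType) (a : I -> K) (A : I -> set R) i x :
  disjointed A -> A i x -> \sum_j a j * \1_(A j) x = a i.
Proof.
move=> dA Aix; rewrite (bigD1 i)//= indicE mem_set// mulr1 big1 ?addr0// => j ji.
by rewrite indicE memNset ?mulr0// => Ajx; rewrite (dA _ _ _ Aix Ajx) eqxx in ji.
Qed.

Lemma sum_indic_out (K : pzRingType) (I : finType) (a : I -> K) (A : I -> set R) x :
  ~ (exists i, A i x) -> \sum_j a j * \1_(A j) x = 0.
Proof.
move=> Ax; rewrite big1// => j _; rewrite indicE memNset ?mulr0// => Ajx.
by apply: Ax; exists j.
Qed.

Definition simple (I : finType) (a : I -> C) (A : I -> set R) (x : R) : C :=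
  \sum_i a i * \1_(A i) x.

Lemma indicCE (A : set R) x : (\1_A x : C) = (\1_A x : R)%:C%C.
Proof. by rewrite !indicE; case: (_ \in _). Qed.

Lemma cmeasurable_indic (A : set R) : measurable A -> cmeasurable (\1_A : R -> C).
Proof.
move=> mA; split.
  rewrite (_ : (fun _ => _) = \1_A); last by apply/funext => x; rewrite indicCE.
  exact: measurable_indic.
rewrite (_ : (fun _ => _) = cst 0); last by apply/funext => x; rewrite indicCE.
exact: measurable_cst.
Qed.

Lemma cmeasurable_sum (I : Type) (s : seq I) (F : I -> R -> C) :
  (forall i, cmeasurable (F i)) -> cmeasurable (fun x => \sum_(i <- s) F i x).
Proof.
move=> mF; elim: s => [|i s ih].
  by under eq_fun do rewrite big_nil; exact: cmeasurable_cst.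
by under eq_fun do rewrite big_cons; exact: cmeasurableD.
Qed.

Lemma integral01_indic (A : set R) : measurable A -> A `<=` I01 ->
  (\int[lam]_(x in I01) (\1_A x)%:E = (mu01 A)%:E)%E.
Proof.
move=> mA AI; transitivity (lam (A `&` I01)); first exact: integral_indic.
by rewrite setIidl// mu01E.
Qed.

Lemma integrable01_indic (A : set R) : measurable A -> A `<=` I01 ->
  lam.-integrable I01 (fun x => (\1_A x)%:E).
Proof.
move=> mA AI; apply/integrableP; split; first exact/measurable_EFinP/measurable_indic.
rewrite [ltLHS](_ : _ = (mu01 A)%:E) ?ltry// -integral01_indic//.
by apply: eq_integral => x _; rewrite /= ger0_norm.
Qed.

Lemma integral_sum_indic (I : finType) (r : I -> R) (A : I -> set R) :
  (forall i, measurable (A i)) -> (forall i, A i `<=` I01) ->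
  (\int[lam]_(x in I01) (\sum_i r i * \1_(A i) x)%:E = (\sum_i r i * mu01 (A i))%:E)%E.
Proof.
move=> mA AI.
under eq_integral do rewrite -sumEFin.
have iA i : lam.-integrable I01 (fun x => (\1_(A i) x)%:E) by exact: integrable01_indic.
rewrite integral_sum//.
  rewrite -sumEFin; apply: eq_bigr => i _.
  under eq_integral do rewrite EFinM.
  by rewrite integralZl// integral01_indic.
by move=> i; apply: (integrableZl _ (r i) (iA i)).
Qed.

Section norm.
Variable p : R.
Hypothesis p1 : 1 <= p.
Let p0 : 0 < p. Proof. exact: lt_le_trans ltr01 p1. Qed.

Lemma inLp_indic (A : set R) : measurable A -> inLp p (\1_A : R -> C).
Proof.
move=> mA; apply: (@inLp_bounded _ p p1 _ 1); first exact: cmeasurable_indic.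
by move=> x _; rewrite indicE; case: (_ \in _); rewrite ?cabs1// cabs0.
Qed.

Lemma inLp_cst (a : C) : inLp p (fun _ : R => a).
Proof. by apply: (@inLp_bounded _ p p1 _ (cabs a)) => //; exact: cmeasurable_cst. Qed.

Lemma inLp_sum (I : Type) (s : seq I) (F : I -> R -> C) :
  (forall i, inLp p (F i)) -> inLp p (fun x => \sum_(i <- s) F i x).
Proof.
move=> mF; elim: s => [|i s ih].
  by under eq_fun do rewrite big_nil; exact: inLp_cst.
by under eq_fun do rewrite big_cons; exact: inLpD.
Qed.

Lemma inLp_simple (I : finType) (a : I -> C) (A : I -> set R) :
  (forall i, measurable (A i)) -> inLp p (simple a A).
Proof.
by move=> mA; apply: inLp_sum => i; apply: inLpZ => //; exact: inLp_indic.
Qed.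

(** At most one summand is nonzero at each point, so the p-th power passes inside the sum; off all
    the sets both sides vanish because 0^p = 0 for p > 0. *)
Lemma Lpint_simple (I : finType) (a : I -> C) (A : I -> set R) :
  (forall i, measurable (A i)) -> (forall i, A i `<=` I01) -> disjointed A ->
  Lpint p (simple a A) = (\sum_i cabs (a i) `^ p * mu01 (A i))%:E.
Proof.
move=> mA AI dA; rewrite -integral_sum_indic// [RHS]integral_mkcond.
apply: eq_integral => x _; rewrite patchE.
have [[i Aix]|nA] := pselect (exists i, A i x).
  rewrite absf_in; last exact: AI Aix.
  rewrite mem_set; last exact: AI Aix.
  by rewrite /simple !(@sum_indic_in _ _ _ _ i).
rewrite sum_indic_out//; have -> : absf (simple a A) x = 0.
  by rewrite /absf /simple sum_indic_out// cabs0 mulr0.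
by rewrite powR0 ?gt_eqF//; case: ifP.
Qed.

Lemma nrm_powR f : inLp p f -> Lpint p f = (nrm p f `^ p)%:E.
Proof. by move=> Lf; rewrite -Lpint_Lpnorm// nrmE// poweR_EFin. Qed.

Lemma nrm_simple (I : finType) (a : I -> C) (A : I -> set R) :
  (forall i, measurable (A i)) -> (forall i, A i `<=` I01) -> disjointed A ->
  nrm p (simple a A) `^ p = \sum_i cabs (a i) `^ p * mu01 (A i).
Proof.
move=> mA AI dA; apply: EFin_inj; rewrite -nrm_powR ?Lpint_simple//.
exact: inLp_simple.
Qed.

Lemma cint01_simple (I : finType) (a : I -> C) (A : I -> set R) :
  (forall i, measurable (A i)) -> (forall i, A i `<=` I01) ->
  cint01 (simple a A) = \sum_i a i * (mu01 (A i))%:C%C.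
Proof.
move=> mA AI; rewrite /cint01.
under eq_integral => x _.
  rewrite /simple (_ : complex.Re _ = \sum_i complex.Re (a i) * \1_(A i) x).
    over.
  rewrite raddf_sum; apply: eq_bigr => i _; rewrite indicCE.
  by case: (a i) => u v /=; rewrite mulr0 subr0.
rewrite integral_sum_indic//.
under eq_integral => x _.
  rewrite /simple (_ : complex.Im _ = \sum_i complex.Im (a i) * \1_(A i) x).
    over.
  rewrite raddf_sum; apply: eq_bigr => i _; rewrite indicCE.
  by case: (a i) => u v /=; rewrite mulr0 add0r.
rewrite integral_sum_indic//=; apply/eqP; rewrite eq_complex/= !raddf_sum/=.
apply/andP; split; apply/eqP; apply: eq_bigr => i _; case: (a i) => u v /=.
  by rewrite mulr0 subr0.
by rewrite mulr0 add0r.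
Qed.

End norm.
End simple.

(** * Approximation by dominated simple functions *)

Section dense.
Variable R : realType.
Local Notation C := (R[i]).
Local Notation lam := (@lebesgue_measure R).
Local Notation I01 := ([set` `[0%R, 1%R]] : set R).

Section approx.
Import HBSimple HBNNSimple.

(** The positive and negative parts are approximated from below. At each point one of the two
    approximants is 0, so the modulus of their difference stays below |g|; this feeds dominated
    convergence and keeps approximants in the unit ball. *)
Lemma dominated_approximation (g : R -> R) : measurable_fun I01 g ->
  exists s : (R -> R)^nat,
   [/\ forall n, measurable_fun setT (s n), forall n, finite_set (range (s n)),
     forall n x, I01 x -> `|s n x| <= `|g x| &
     forall x, I01 x -> s ^~ x @ \oo --> g x].
Proof.
move=> mg; have mI : measurable I01 by [].
have mf : measurable_fun I01 (EFin \o g) by exact/measurable_EFinP.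
have gP x : (EFin \o g)^\+%E x = (Num.max (g x) 0)%:E by rewrite funeposE EFin_max.
have gN x : (EFin \o g)^\-%E x = (Num.max (- g x) 0)%:E by rewrite funenegE EFin_max.
pose P := nnsfun_approx mI (measurable_funepos mf).
pose N := nnsfun_approx mI (measurable_funeneg mf).
have leAP n x : I01 x -> ((P n x)%:E <= (EFin \o g)^\+ x)%E.
  by move=> Ix; rewrite /P nnsfun_approxE; apply: le_approx => // y _; exact: funepos_ge0.
have leAN n x : I01 x -> ((N n x)%:E <= (EFin \o g)^\- x)%E.
  by move=> Ix; rewrite /N nnsfun_approxE; apply: le_approx => // y _; exact: funeneg_ge0.
exists (fun n x => P n x - N n x); split.
- by move=> n; apply: measurable_funB; exact: measurable_funPT.
- move=> n; apply: (@sub_finite_set _ _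
    ((fun uv => uv.1 - uv.2) @` (range (P n) `*` range (N n)))).
    by move=> _ [x _ <-]; exists (P n x, N n x).
  by apply: finite_image; apply: finite_setX; exact: fimfunP.
- move=> n x Ix; have := leAP n x Ix; have := leAN n x Ix.
  rewrite gP gN !lee_fin.
  have : 0 <= P n x by []. have : 0 <= N n x by [].
  have [g0|g0] := leP 0 (g x).
    rewrite (max_idPr _) ?oppr_le0// (ger0_norm g0) => N0 P0 NN PP.
    rewrite ler_norml; apply/andP; split; lra.
  rewrite (max_idPl _) ?oppr_ge0 ?(ltW g0)// (ltr0_norm g0) => N0 P0 NN PP.
  rewrite ler_norml; apply/andP; split; lra.
move=> x Ix.
have /fine_cvg cP : EFin \o P ^~ x @ \oo --> (Num.max (g x) 0)%:E.
  by rewrite -gP; apply: cvg_nnsfun_approx => // y _; exact: funepos_ge0.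
have /fine_cvg cN : EFin \o N ^~ x @ \oo --> (Num.max (- g x) 0)%:E.
  by rewrite -gN; apply: cvg_nnsfun_approx => // y _; exact: funeneg_ge0.
have -> : g x = Num.max (g x) 0 - Num.max (- g x) 0.
  have [g0|g0] := leP 0 (g x).
    by rewrite (max_idPr _) ?oppr_le0// subr0.
  by rewrite (max_idPl _) ?oppr_ge0 ?(ltW g0)// sub0r opprK.
exact: (cvgB cP cN).
Qed.

End approx.

Section p.
Variable p : R.
Hypothesis p1 : 1 <= p.
Let p0 : 0 < p. Proof. exact: lt_le_trans ltr01 p1. Qed.

(** Since p >= 1, y^p <= y as soon as y <= 1, and y itself squeezes the power. *)
Lemma cvg_powR0 (y : R^nat) : (forall n, 0 <= y n) -> y @ \oo --> (0 : R) ->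
  (fun n => y n `^ p) @ \oo --> (0 : R).
Proof.
move=> y0 cy; apply: (@squeeze_cvgr _ _ _ _ (cst 0) y) => //; last exact: cvg_cst.
near=> n; rewrite powR_ge0/=.
have [->|yn0] := eqVneq (y n) 0; first by rewrite powR0// gt_eqF.
apply: ge1r_powR => //; rewrite lt_neqAle eq_sym yn0 y0/= ltW//.
have -> : y n = `|0 - y n| by rewrite sub0r normrN ger0_norm.
by near: n; move/cvgrPdist_lt : cy => /(_ 1 ltr01).
Unshelve. all: end_near. Qed.

Lemma integrable_Lpint (f : R -> C) : inLp p f ->
  lam.-integrable setT (fun x => (absf f x `^ p)%:E).
Proof.
move=> Lf; apply/integrableP; split; first exact: measurable_absfp Lf.1.
rewrite [ltLHS](_ : _ = Lpint p f); last first.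
  by apply: eq_integral => x _; rewrite gee0_abs// lee_fin powR_ge0.
by rewrite nrm_powR// ltry.
Qed.

(** Dominated convergence with majorant |2f|^p, because |f - h_n| <= 2|f|. *)
Lemma dominated_Lpint (f : R -> C) (h : (R -> C)^nat) : inLp p f ->
  (forall n, cmeasurable (h n)) ->
  (forall n x, I01 x -> cabs (h n x) <= cabs (f x)) ->
  (forall x, I01 x -> (fun n => cabs (f x - h n x)) @ \oo --> (0 : R)) ->
  (fun n => Lpint p (fun x => f x - h n x)) @ \oo --> 0%E.
Proof.
move=> Lf mh hf cf; have L2f : inLp p (fun x => 2 * f x) by exact: inLpZ.
have mfh n : cmeasurable (fun x => f x - h n x).
  by apply: (inLpB p1 Lf _).1; apply: inLp_le (mh n) Lf (hf n).
have [] := @dominated_convergence _ _ R lam setT measurableT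
  (fun n x => (absf (fun x => f x - h n x) x `^ p)%:E) (cst 0%E)
  (fun x => (absf (fun x => 2 * f x) x `^ p)%:E).
- by move=> n; exact: measurable_absfp.
- exact: measurable_cst.
- apply: aeW => x _; apply: cvg_EFin; first exact: nearW.
  have [Ix|Ix] := pselect (I01 x); last first.
    under eq_fun do rewrite /= absf_out// powR0 ?gt_eqF//.
    exact: cvg_cst.
  under eq_fun do rewrite /= absf_in//.
  by apply: cvg_powR0; [move=> n; exact: cabs_ge0|exact: cf].
- exact: integrable_Lpint.
- apply: aeW => x n _; rewrite gee0_abs ?lee_fin ?powR_ge0//.
  rewrite ge0_ler_powR ?nnegrE ?absf_ge0 ?(ltW p0)//.
  have [Ix|Ix] := pselect (I01 x); last by rewrite !absf_out.
  rewrite !absf_in// (le_trans (ler_cabsD _ _))// cabsN cabsM.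
  rewrite cabs_nat mulr_natl mulr2n.
  by rewrite lerD2l hf.
by move=> _ _; rewrite integral0.
Qed.

(** L^p embeds in L^1 on a finite measure space: y <= 1 + y^p for y >= 0. *)
Lemma integrable_le_Lp (f : R -> C) (g : R -> R) : inLp p f -> measurable_fun I01 g ->
  (forall x, I01 x -> `|g x| <= cabs (f x)) -> lam.-integrable I01 (fun x => (g x)%:E).
Proof.
move=> Lf mg gf.
have i1 : lam.-integrable I01 (cst 1%E).
  apply/integrableP; split; first exact: measurable_cst.
  rewrite [ltLHS](_ : _ = 1%E) ?ltry//.
  transitivity (\int[lam]_(x in I01) (cst 1%E) x)%E.
    by apply: eq_integral => x _; rewrite /= normr1.
  by rewrite integral_cst//= mul1e lam_I01.
have iG := integrableD _ i1 (integrableS measurableT _ (@subsetT _ _) (integrable_Lpint Lf)).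
apply: le_integrable (iG _ _) => //; first exact/measurable_EFinP.
move=> x Ix; rewrite /= -?EFinD lee_fin (le_trans (gf _ Ix))// ger0_norm ?addr_ge0 ?powR_ge0//.
rewrite absf_in//; have := cabs_ge0 (f x); move: (cabs _) => y y0.
have [y1|y1] := leP y 1; first by rewrite (le_trans y1)// lerDl powR_ge0.
rewrite (le_trans (y := y `^ p))// ?lerDr//.
rewrite -[leLHS]powRr1//; apply: ler_powR => //; exact: ltW.
Qed.

Lemma dominated_Rint (f : R -> C) (g : R -> R) (s : (R -> R)^nat) : inLp p f ->
  measurable_fun I01 g -> (forall n, measurable_fun I01 (s n)) ->
  (forall x, I01 x -> `|g x| <= cabs (f x)) ->
  (forall n x, I01 x -> `|s n x| <= `|g x|) ->
  (forall x, I01 x -> s ^~ x @ \oo --> g x) ->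
  (fun n => fine (\int[lam]_(x in I01) (s n x)%:E)) @ \oo -->
    fine (\int[lam]_(x in I01) (g x)%:E).
Proof.
move=> Lf mg ms gf sg cs; have ig := integrable_le_Lp Lf mg gf.
have mI : measurable I01 by [].
have fg : (\int[lam]_(x in I01) (g x)%:E \is a fin_num)%E by exact: integrable_fin_num.
have [||||||_ _] := @dominated_convergence _ _ R lam I01 _
  (fun n x => (s n x)%:E) (fun x => (g x)%:E) (fun x => `|(g x)%:E|%E).
- exact: mI.
- by move=> n; apply/measurable_EFinP; exact: ms.
- by apply/measurable_EFinP; exact: mg.
- by apply: aeW => x Ix; apply: cvg_EFin; [exact: nearW|exact: cs].
- exact: integrable_abse.
- by apply: aeW => x n Ix; rewrite lee_fin sg.
by rewrite -[X in _ --> X -> _](fineK fg) => /fine_cvg.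
Qed.

Lemma eq_Lpnorm01 (f g : R -> C) : (forall x, I01 x -> f x = g x) -> Lpnorm p f = Lpnorm p g.
Proof.
move=> fg; rewrite !LpnormE (_ : Lpint p f = Lpint p g)//; apply: eq_integral => x _.
have [Ix|Ix] := pselect (I01 x); last by rewrite !absf_out.
by rewrite !absf_in// fg.
Qed.

Lemma eq_cint01 (f g : R -> C) : (forall x, I01 x -> f x = g x) -> cint01 f = cint01 g.
Proof.
by move=> fg; rewrite /cint01; congr (Complex (fine _) (fine _)); apply: eq_integral => x;
  rewrite inE => Ix; rewrite fg.
Qed.

(** Real and imaginary parts are approximated separately. Closeness of the integrals is recorded as
    well, because the operator under study subtracts a multiple of the mean. *)
Lemma simple_approx (f : R -> C) (e : R) : inLp p f -> 0 < e ->
  exists (I : finType) (a : I -> C) (A : I -> set R),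
   [/\ [/\ forall i, measurable (A i), forall i, A i `<=` I01, disjointed A &
       forall x, I01 x -> exists i, A i x],
      forall x, I01 x -> cabs (simple a A x) <= cabs (f x),
      nrm p (fun x => f x - simple a A x) < e &
      cabs (cint01 f - cint01 (simple a A)) < e].
Proof.
move=> Lf e0; have [mRe mIm] := Lf.1.
have [s [ms fs ds cs]] := dominated_approximation mRe.
have [t [mt ft dt ct]] := dominated_approximation mIm.
pose h n x : C := Complex (s n x) (t n x).
have ms' n : measurable_fun I01 (s n) by exact: measurable_funTS.
have mt' n : measurable_fun I01 (t n) by exact: measurable_funTS.
have mh n : cmeasurable (h n) by split; [exact: ms'|exact: mt'].
have hf n x : I01 x -> cabs (h n x) <= cabs (f x).
  by move=> Ix; apply: ler_cabs_ReIm; [exact: ds|exact: dt].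
have Lh n : inLp p (h n) by apply: inLp_le (mh n) Lf (hf n).
have cf x : I01 x -> (fun n => cabs (f x - h n x)) @ \oo --> (0 : R).
  move=> Ix; apply: (@squeeze_cvgr _ _ _ _ (cst 0)
    (fun n => `|complex.Re (f x) - s n x| + `|complex.Im (f x) - t n x|)).
  - apply: nearW => n; rewrite cabs_ge0/=.
    rewrite (le_trans (cabs_le_ReIm _))// /h; by case: (f x).
  - exact: cvg_cst.
  have -> : (0 : R) = `|complex.Re (f x) - complex.Re (f x)| +
      `|complex.Im (f x) - complex.Im (f x)| by rewrite !subrr normr0 addr0.
  by apply: cvgD; apply: cvg_norm; apply: cvgB;
    [exact: cvg_cst|exact: cs|exact: cvg_cst|exact: ct].
have cN := dominated_Lpint Lf mh hf cf.
have cR := dominated_Rint Lf mRe ms' (fun x _ => ler_Re_cabs (f x)) ds cs.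
have cI := dominated_Rint Lf mIm mt' (fun x _ => ler_Im_cabs (f x)) dt ct.
have ep0 : 0 < e `^ p by rewrite powR_gt0.
have e20 : 0 < e / 2 by rewrite divr_gt0.
have [n [n1 n2 n3]] : exists n, [/\ (Lpint p (fun x => (f x - h n x)%R) < (e `^ p)%:E)%E,
   `|fine (\int[lam]_(x in I01) (complex.Re (f x))%:E) -
     fine (\int[lam]_(x in I01) (s n x)%:E)| < e / 2 &
   `|fine (\int[lam]_(x in I01) (complex.Im (f x))%:E) -
     fine (\int[lam]_(x in I01) (t n x)%:E)| < e / 2].
  have /fine_cvgP[_ /cvgrPdist_lt /(_ _ ep0) E1] := cN.
  move/cvgrPdist_lt : cR => /(_ _ e20) E2.
  move/cvgrPdist_lt : cI => /(_ _ e20) E3.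
  near \oo => n; exists n; split.
  - have : `|0 - fine (Lpint p (fun x => f x - h n x))| < e `^ p by near: n; exact: E1.
    rewrite sub0r normrN ger0_norm ?fine_ge0 ?Lpint_ge0// -lte_fin fineK//.
    by rewrite nrm_powR//; exact: inLpB.
  - by near: n; exact: E2.
  - by near: n; exact: E3.
(* The pieces are the joint level sets of the two approximants; a pair of values never taken
   together gives an empty piece. *)
pose I : finType := (fset_set (range (s n)) * fset_set (range (t n)))%type.
pose a (i : I) : C := Complex (val i.1) (val i.2).
pose A (i : I) : set R := I01 `&` (s n @^-1` [set val i.1] `&` t n @^-1` [set val i.2]).
have mA i : measurable (A i).
  apply: measurableI => //; apply: measurableI; rewrite -[X in measurable X]setTI.
    exact: ms.
  exact: mt.
have AI i : A i `<=` I01 by move=> x [].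
have dA : disjointed A.
  move=> [i1 i2] [j1 j2] x [_ [/= e1 e2]] [_ [/= e3 e4]].
  by congr (_, _); apply: val_inj; rewrite /= -?e1 -?e2 ?e3 ?e4.
have cA x : I01 x -> exists i, A i x /\ h n x = a i.
  move=> Ix.
  have sx : s n x \in fset_set (range (s n)) by rewrite in_fset_set// inE; exists x.
  have tx : t n x \in fset_set (range (t n)) by rewrite in_fset_set// inE; exists x.
  by exists ([` sx]%fset, [` tx]%fset).
have hE x : I01 x -> h n x = simple a A x.
  by move=> Ix; have [i [Ai ->]] := cA _ Ix; rewrite /simple (@sum_indic_in _ _ _ _ _ i).
exists I, a, A; split.
- by split => // x Ix; have [i []] := cA _ Ix; exists i.
- by move=> x Ix; rewrite -hE// hf.
- rewrite /nrm (@eq_Lpnorm01 _ (fun x => f x - h n x)); last first.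
    by move=> x Ix; rewrite hE.
  rewrite -/(nrm p _) ltNge; apply/negP => en.
  move: n1; rewrite nrm_powR//; last exact: inLpB.
  by rewrite lte_fin ltNge ge0_ler_powR ?nnegrE ?nrm_ge0 ?(ltW e0) ?(ltW p0).
rewrite -(eq_cint01 hE) (le_lt_trans (cabs_le_ReIm _))//= (splitr e).
exact: ltrD.
Unshelve. all: end_near. Qed.

End p.
End dense.

(** * Splitting sets along a narrow operator *)

Section subset.
Variable R : realType.
Local Notation lam := (@lebesgue_measure R).
Local Notation I01 := ([set` `[0%R, 1%R]] : set R).

Lemma mu01D (A B : set R) : measurable A -> measurable B -> A `<=` I01 -> B `<=` A ->
  mu01 (A `\` B) = mu01 A - mu01 B.
Proof.
move=> mA mB AI BA.
have BI : B `<=` I01 by exact: subset_trans BA AI.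
have DI : A `\` B `<=` I01 by move=> x [/AI].
apply/eqP; rewrite eq_sym subr_eq; apply/eqP; apply: EFin_inj.
rewrite EFinD -!mu01E//; last exact: measurableD.
rewrite -measureU//; [by rewrite setUC setDUK|exact: measurableD|].
by rewrite setIC setDIK.
Qed.

(** Monotonicity and the Lipschitz bound together give the continuity needed for intermediate
    values. *)
Lemma mu01_itv_lip (A : set R) x y : measurable A -> A `<=` I01 -> x <= y ->
  mu01 (A `&` `[0, x]) <= mu01 (A `&` `[0, y]) <= mu01 (A `&` `[0, x]) + (y - x).
Proof.
move=> mA AI xy.
have mAz z : measurable (A `&` `[0, z]) by exact: measurableI.
have sAz z : A `&` `[0, z] `<=` I01 by move=> u [/AI].
apply/andP; split.
  rewrite -lee_fin -!mu01E//; apply: le_measure; rewrite ?inE; [exact: mAz|exact: mAz|].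
  move=> u [Au ux]; split=> //; move: ux; rewrite /= !in_itv/= => /andP[-> ux].
  by rewrite (le_trans ux).
rewrite -lee_fin EFinD -!mu01E//.
have -> : (y - x)%:E = lam [set` `]x, y]].
  by rewrite lebesgue_measure_itv/= lte_fin; case: ltgtP xy => // -> _; rewrite subrr.
apply: (@le_trans _ _ (lam ((A `&` `[0, x]) `|` `]x, y]))); last first.
  by apply: measureU2 => //; exact: mAz.
apply: le_measure; rewrite ?inE; [exact: mAz|by apply: measurableU => //; exact: mAz|].
move=> u [Au]; rewrite /= !in_itv/= => /andP[u0 uy].
by have [ux|xu] := leP u x; [left; split => //|right]; rewrite ?u0 ?uy.
Qed.

(** Intermediate value theorem for x -> |A [&] [0,x]|, which runs from 0 to |A|. No control on T is
    asked for here. *)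
Lemma exists_subset (A : set R) t : measurable A -> A `<=` I01 -> 0 <= t <= 1 ->
  exists B : set R, [/\ measurable B, B `<=` A & mu01 B = t * mu01 A].
Proof.
move=> mA AI /andP[t0 t1]; pose F x := mu01 (A `&` `[0, x]).
have F0 : F 0 = 0.
  rewrite /F /mu01 (_ : lam _ = 0%E)//; apply: (@subset_measure0 _ _ _ lam _ [set 0%R]) => //.
  - exact: measurableI.
  - by move=> x [_]; rewrite set_itv1.
  - exact: lebesgue_measure_set1.
have F1 : F 1 = mu01 A by rewrite /F setIidl.
have mA0 := mu01_ge0 A.
have [||c c01 Fc] := @IVT R F 0 1 (t * mu01 A) ler01.
- apply: continuous_subspaceT => x; apply/cvgrPdist_le => /= e e0.
  near=> y; have : `|x - y| <= e by near: y; exact: cvgr_dist_le.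
  apply: le_trans; have [xy|yx] := leP x y.
    have /andP[h1 h2] := mu01_itv_lip mA AI xy.
    rewrite distrC ger0_norm ?subr_ge0// distrC ger0_norm ?subr_ge0// lerBlDl//.
  have /andP[h1 h2] := mu01_itv_lip mA AI (ltW yx).
  rewrite ger0_norm ?subr_ge0// ger0_norm ?subr_ge0 ?(ltW yx)// lerBlDl//.
- rewrite F0 F1 (min_idPl _)// (max_idPr _)// mulr_ge0//=.
  by rewrite ler_piMl.
by exists (A `&` `[0, c]); split => //; exact: measurableI.
Unshelve. all: end_near. Qed.

End subset.

(** * Bounded operators, deviations, and cutting with control on T *)

Section op.
Variable R : realType.
Local Notation C := (R[i]).
Local Notation lam := (@lebesgue_measure R).
Local Notation I01 := ([set` `[0%R, 1%R]] : set R).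
Variable p : R.
Hypothesis p1 : 1 <= p.
Variable T : (R -> C) -> (R -> C).
Hypothesis bT : bounded_op p T.

Lemma inLpT f : inLp p f -> inLp p (T f).
Proof. by case: bT => h _ _ _; exact: h. Qed.

Lemma nrmT_bound : exists2 M, 0 <= M & forall f, inLp p f -> nrm p (T f) <= M * nrm p f.
Proof.
case: bT => _ _ _ [M hM]; exists `|M| => // f Lf.
have := hM f Lf; rewrite !nrmE//; last exact: inLpT.
rewrite -EFinM lee_fin => /le_trans; apply.
by rewrite ler_wpM2r ?nrm_ge0// ler_norm.
Qed.

Lemma ae_T_lin a f g : inLp p f -> inLp p g ->
  ae01 (T (fun x => a * f x + g x)) (fun x => a * T f x + T g x).
Proof. by case: bT => _ _ h _; exact: h. Qed.

(** T is linear only almost everywhere on representatives; norms do not see this, so linearity is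
    used in this subadditive form. *)
Lemma nrmT_lin a f g : inLp p f -> inLp p g ->
  nrm p (T (fun x => a * f x + g x)) <= cabs a * nrm p (T f) + nrm p (T g).
Proof.
move=> Lf Lg; have LT1 := inLpT Lf; have LT2 := inLpT Lg.
rewrite (nrm_ae _ _ (ae_T_lin a Lf Lg)).
- by rewrite -nrmZ// nrmD//; exact: inLpZ.
- by apply: inLpT; apply: inLpD => //; exact: inLpZ.
- by apply: inLpD => //; exact: inLpZ.
Qed.

Lemma nrm0 : nrm p (fun _ : R => 0 : C) = 0.
Proof.
have -> : (fun _ : R => 0 : C) = (fun x : R => 0 * (fun _ => 0) x).
  by apply/funext => x; rewrite mulr0.
by rewrite nrmZ ?cabs0 ?mul0r//; exact: inLp_cst.
Qed.

Lemma nrmT0 : nrm p (T (fun _ : R => 0 : C)) = 0.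
Proof.
have [M M0 hM] := nrmT_bound; apply/eqP; rewrite eq_le nrm_ge0 andbT.
by rewrite (le_trans (hM _ (inLp_cst p1 _)))// nrm0 mulr0.
Qed.

Lemma nrmT_scale a f : inLp p f -> nrm p (T (fun x => a * f x)) <= cabs a * nrm p (T f).
Proof.
move=> Lf; have := nrmT_lin a Lf (inLp_cst p1 0).
rewrite nrmT0 addr0.
by rewrite (_ : (fun x => a * f x + 0) = (fun x => a * f x))//; apply/funext => x; rewrite addr0.
Qed.

Lemma nrmT_sum (I : Type) (s : seq I) (a : I -> C) (F : I -> R -> C) :
  (forall i, inLp p (F i)) ->
  nrm p (T (fun x => \sum_(i <- s) a i * F i x)) <= \sum_(i <- s) cabs (a i) * nrm p (T (F i)).
Proof.
move=> LF; elim: s => [|i s ih].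
  by rewrite big_nil; under eq_fun do rewrite big_nil; rewrite nrmT0.
rewrite big_cons; under eq_fun do rewrite big_cons.
rewrite (le_trans (nrmT_lin _ (LF i) _)) ?lerD2l//.
by apply: inLp_sum => // j; apply: inLpZ.
Qed.

(** The norm of [T (dev t A B)] tells how far T 1_B is from t T 1_A, that is, how well B passes for
    a fraction t of A in the eyes of T. *)
Definition dev (t : R) (A B : set R) : R -> C := fun x => \1_B x - t%:C%C * \1_A x.

Lemma inLp_dev t A B : measurable A -> measurable B -> inLp p (dev t A B).
Proof. by move=> mA mB; apply: inLpB => //; [|apply: inLpZ => //]; exact: inLp_indic. Qed.

Lemma nrm_indic (A : set R) : measurable A -> A `<=` I01 ->
  nrm p (\1_A : R -> C) = mu01 A `^ p^-1.
Proof.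
move=> mA AI; have p_neq0 : p != 0 by rewrite gt_eqF// (lt_le_trans ltr01 p1).
have := @nrm_simple _ p p1 unit (fun=> 1) (fun=> A) (fun=> mA) (fun=> AI).
rewrite (_ : simple _ _ = \1_A); last first.
  by apply/funext => x; rewrite /simple big_const card_unit/= addr0 mul1r.
move=> /(_ _)/(congr1 (fun y => y `^ p^-1)).
rewrite -powRrM mulfV// powRr1 ?nrm_ge0// big_const card_unit/= addr0 cabs1 powR1 mul1r.
by apply => -[] [].
Qed.

Hypothesis nT : narrow p T.

(** A sign on A is g = 2 1_B - 1_A with B = {g = 1}. Mean zero then says |B| = |A| / 2, and the
    deviation at ratio 1/2 is g / 2. *)
Lemma halve (A : set R) e : measurable A -> A `<=` I01 -> 0 < mu01 A -> 0 < e ->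
  exists B : set R, [/\ measurable B, B `<=` A, mu01 B = mu01 A / 2 &
    nrm p (T (dev 2^-1 A B)) <= e].
Proof.
move=> mA AI A0 e0.
have lA0 : (0 < lam A)%E by rewrite mu01E.
have [g [[mg [gv g2]] [g0 Tg]]] := nT mA AI lA0 e0.
pose B : set R := g @^-1` [set 1].
have BA : B `<=` A.
  move=> x /= gx; have := g2 x; rewrite gx expr1n indicE.
  by case: (boolP (x \in A)) => [|_ /eqP]; rewrite ?inE// oner_eq0.
have mB : measurable B by rewrite -[B]setTI; exact: mg.
have BI : B `<=` I01 by exact: subset_trans BA AI.
have gE x : g x = 2 * \1_B x - \1_A x.
  have nB : g x != 1 -> \1_B x = 0 :> R by move=> /eqP gx; rewrite indicE memNset.
  have yB : g x = 1 -> \1_B x = 1 :> R by move=> gx; rewrite indicE mem_set.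
  rewrite -g2; case: (gv x) => [gx|[gx|gx]].
  - by rewrite nB gx ?eqNr ?oner_eq0// sqrrN expr1n mulr0 sub0r.
  - by rewrite nB gx ?(eq_sym 0) ?oner_eq0// expr0n mulr0 sub0r oppr0.
  - by rewrite yB gx// expr1n mulr1; lra.
exists B; split => //.
  (* The formula for integrals of sums of indicators does not ask for disjointness, so it applies to
     the nested sets B and A. *)
  have : (\int[lam]_(x in I01) (g x)%:E =
      (\sum_(b : bool) (if b then 2 else -1) * mu01 (if b then B else A))%:E)%E.
    rewrite -integral_sum_indic; [|by case|by case].
    by apply: eq_integral => x _; rewrite big_bool/= mulN1r gE.
  by rewrite g0 big_bool/= mulN1r => /(congr1 fine)/= h; lra.
have Lg : inLp p (fun x => Complex (g x) 0).
  apply: (@inLp_bounded _ p p1 _ 1).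
    by split; [exact: measurable_funTS|exact: measurable_cst].
  move=> x _; rewrite cabs_real; case: (gv x) => [->|[->|->]];
    by rewrite ?normrN ?normr1 ?normr0.
rewrite (_ : dev _ _ _ = (fun x => (2^-1 : R)%:C%C * Complex (g x) 0)); last first.
  apply/funext => x; rewrite /dev !indicCE -[Complex _ _]/((g x)%:C)%C -!rmorphM -rmorphB/=.
  by rewrite gE; congr (_%:C)%C; lra.
rewrite (le_trans (nrmT_scale _ Lg))// cabs_real.
have : nrm p (T (fun x => Complex (g x) 0)) < e.
  by rewrite -lte_fin -nrmE//; exact: inLpT.
have := nrm_ge0 p (T (fun x => Complex (g x) 0)).
by rewrite ger0_norm ?invr_ge0//; lra.
Qed.

(* Repeated exact halving of [A] approaches the ratio [t]; after [n] steps the part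
   still to be cut has measure [2^-n * mu01 A] and is cut without control on [T],
   which costs at most [M] times the norm of its indicator. *)
Lemma split_bound : exists2 M, 0 <= M & forall n (A : set R) t e,
  measurable A -> A `<=` I01 -> 0 <= t <= 1 -> 0 < e ->
  exists B : set R, [/\ measurable B, B `<=` A, mu01 B = t * mu01 A &
    nrm p (T (dev t A B)) <= e + M * (2^-1 `^ p^-1) ^+ n * mu01 A `^ p^-1].
Proof.
have [M M0 hM] := nrmT_bound; exists M => //.
have base (A : set R) t : measurable A -> A `<=` I01 -> 0 <= t <= 1 ->
  exists B : set R, [/\ measurable B, B `<=` A, mu01 B = t * mu01 A &
    nrm p (T (dev t A B)) <= M * mu01 A `^ p^-1].
  move=> mA AI t01; have [B [mB BA muB]] := exists_subset mA AI t01.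
  exists B; split => //; apply: le_trans (hM _ (inLp_dev t mA mB)) _.
  rewrite ler_wpM2l// -nrm_indic//; apply: nrm_le => //.
  - exact: inLp_dev.
  - exact: inLp_indic.
  (* Pointwise |1_B - t 1_A| <= 1_A, as B lies in A and 0 <= t <= 1. *)
  move=> x _; rewrite /dev !indicCE -rmorphM -rmorphB !cabs_real !indicE.
  case: (boolP (x \in B)) => [|_]; rewrite ?inE.
    by move=> /BA Ax; rewrite mem_set//= mulr1 normr1 ger0_norm; lra.
  by rewrite sub0r normrN normrM ler_piMl// ger0_norm; lra.
elim=> [|n ih] A t e mA AI t01 e0.
  have [B [? ? ? h]] := base A t mA AI t01; exists B; split=> //.
  by rewrite expr0 mulr1 (le_trans h)// lerDr ltW.
(* Halving is available only for positive measure; on a null set the crude bound [base] is already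
   0. *)
have [A0|A0] := leP (mu01 A) 0.
  have mu0 : mu01 A = 0 by apply/eqP; rewrite eq_le A0 mu01_ge0.
  have [B [? ? ? h]] := base A t mA AI t01; exists B; split=> //.
  have p_neq0 : p^-1 != 0 by rewrite invr_eq0 gt_eqF// (lt_le_trans ltr01 p1).
  by move: h; rewrite mu0 powR0// !mulr0 addr0 => h; rewrite (le_trans h)// ltW.
have e20 : 0 < e / 2 by rewrite divr_gt0.
have [A1 [mA1 A1A muA1 TA1]] := halve mA AI A0 e20.
have A1I : A1 `<=` I01 by exact: subset_trans A1A AI.
(* Passing to the complement in A exchanges t and 1 - t and only changes the sign of the deviation.
   For t <= 1/2 the set B fits inside one half of A, at ratio 2t. *)
wlog t2 : t t01 / t <= 2^-1.
  move=> hw; have [t2|t2] := leP t 2^-1; first exact: hw.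
  have [||B [mB BA muB TB]] := hw (1 - t); [by lra|by lra|].
  exists (A `\` B); split.
  - exact: measurableD.
  - exact: subDsetl.
  - by rewrite mu01D// muB; lra.
  apply: le_trans TB.
  have -> : dev t A (A `\` B) = (fun x => (-1) * dev (1 - t) A B x).
    apply/funext => x; rewrite /dev !indicE rmorphB rmorph1.
    case: (boolP (x \in B)) => [|/negP]; rewrite ?inE => xB.
      have Ax := BA _ xB.
      rewrite [x \in A `\` _]memNset; last by case.
      by rewrite mem_set//=; ring.
    case: (boolP (x \in A)) => [|/negP]; rewrite ?inE => xA.
      by rewrite mem_set//=; ring.
    by rewrite memNset/=; [ring|case].
  by rewrite (le_trans (nrmT_scale _ (inLp_dev _ mA mB)))// cabsN cabs1 mul1r.
have t201 : 0 <= 2 * t <= 1 by lra.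
have [B [mB BA1 muB TB]] := ih A1 (2 * t) (e / 2) mA1 A1I t201 e20.
exists B; split.
- exact: mB.
- exact: subset_trans BA1 A1A.
- by rewrite muB muA1; lra.
(* The scales add up: 2t <= 1 times the deviation of the half in A, plus the deviation of B in the
   half. *)
have -> : dev t A B = (fun x => (2 * t)%:C%C * dev 2^-1 A A1 x + dev (2 * t) A1 B x).
  have tE : t%:C%C = (2 * t)%:C%C * (2^-1)%:C%C :> C by rewrite -rmorphM; congr (_%:C)%C; lra.
  by apply/funext => x; rewrite /dev tE; ring.
apply: le_trans (nrmT_lin _ (inLp_dev _ mA mA1) (inLp_dev _ mA1 mB)) _.
(* Halving the measure multiplies its 1/p-th power by 2^(-1/p), the extra factor of step n + 1. *)
move: TB; rewrite muA1 powRM ?mu01_ge0// cabs_real ger0_norm; last by lra.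
rewrite exprSr => TB.
have : 2 * t * nrm p (T (dev 2^-1 A A1)) <= e / 2.
  by rewrite (le_trans _ TA1)// ler_piMl ?nrm_ge0//; lra.
lra.
Qed.

(** The remainder in [split_bound] decays geometrically, with ratio r = 2^(-1/p) < 1, uniformly in A
    because |A| <= 1. *)
Lemma split_set (A : set R) t e : measurable A -> A `<=` I01 -> 0 <= t <= 1 -> 0 < e ->
  exists B : set R, [/\ measurable B, B `<=` A, mu01 B = t * mu01 A &
    nrm p (T (dev t A B)) <= e].
Proof.
move=> mA AI t01 e0; have [M M0 hM] := split_bound.
have e20 : 0 < e / 2 by rewrite divr_gt0.
have p0 : 0 < p by exact: lt_le_trans ltr01 p1.
set r := (2^-1 : R) `^ p^-1 in hM.
have pw1 : (1 : R) `^ p^-1 = 1 by rewrite powR1.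
have r0 : 0 <= r by exact: powR_ge0.
have r1 : `|r| < 1.
  rewrite ger0_norm// -[ltRHS]pw1 gt0_ltr_powR ?invr_gt0 ?nnegrE//.
  by rewrite invf_lt1// ltr1n.
have [n hn] : exists n, M * r ^+ n <= e / 2.
  have /cvgrPdist_le /(_ _ e20) : (fun n => M * r ^+ n) @ \oo --> (0 : R).
    by rewrite -(mulr0 M); apply: cvgMr; exact: cvg_expr.
  move=> [n _ /(_ n (leqnn n))]; rewrite sub0r normrN => h.
  by exists n; rewrite (le_trans _ h)// ler_norm.
have [B [mB BA muB TB]] := hM n A t _ mA AI t01 e20.
exists B; split=> //; apply: (le_trans TB).
rewrite [leRHS](splitr e) lerD2l (le_trans _ hn)// ler_piMr//.
  by rewrite mulr_ge0// exprn_ge0.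
rewrite -[leRHS]pw1 ge0_ler_powR ?invr_ge0 ?nnegrE ?mu01_ge0 ?(ltW p0)//.
exact: mu01_le1.
Qed.

(** Pieces are cut off one at a time from what is left, with ratios rescaled by 1 / (1 - b i). Each
    round spends half of the allowed error, and the rescaled ratios are at most 1, so errors
    inherited from earlier cuts are not amplified. *)
Lemma partition_set (I : eqType) (s : seq I) (A : set R) (b : I -> R) e :
  uniq s -> measurable A -> A `<=` I01 -> (forall i, 0 <= b i) ->
  \sum_(i <- s) b i <= 1 -> 0 < e ->
  exists B : I -> set R,
  [/\ forall i, measurable (B i), forall i, B i `<=` A,
      forall i j x, i \in s -> j \in s -> B i x -> B j x -> i = j &
      forall i, i \in s -> mu01 (B i) = b i * mu01 A /\ nrm p (T (dev (b i) A (B i))) <= e].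
Proof.
elim: s A b e => [|i s ih] A b e us mA AI b0 b1 e0.
  by exists (fun=> set0); split => [i|i x||].
move: us b1; rewrite big_cons => /= /andP[is_s us] b1.
have e20 : 0 < e / 2 by rewrite divr_gt0.
have sb0 : 0 <= \sum_(j <- s) b j by exact: sumr_ge0.
have bi01 : 0 <= b i <= 1 by rewrite b0/=; lra.
have [B0 [mB0 B0A muB0 TB0]] := split_set mA AI bi01 e20.
(* If [b i = 1], then [c j = b j / 0 = 0], which is right because [b j = 0]. *)
pose c j := b j / (1 - b i).
have c0 j : 0 <= c j by rewrite divr_ge0//; lra.
have mD : measurable (A `\` B0) by exact: measurableD.
have DI : A `\` B0 `<=` I01 by move=> x [/AI].
have sc : \sum_(j <- s) c j <= 1.
  rewrite -mulr_suml; have [->|bi] := eqVneq (b i) 1; first by rewrite subrr invr0 mulr0.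
  by rewrite ler_pdivrMr; lra.
have [B [mB BD dB hB]] := ih _ c _ us mD DI c0 sc e20.
have cb j : j \in s -> c j * (1 - b i) = b j /\ c j <= 1.
  move=> js; have bj : b j <= \sum_(k <- s) b k.
    by rewrite (big_rem _ js)/= lerDl sumr_ge0.
  have cj : c j <= \sum_(k <- s) c k.
    by rewrite (big_rem _ js)/= lerDl sumr_ge0.
  split; last exact: le_trans cj sc.
  have [bi|bi] := eqVneq (b i) 1.
    by rewrite bi subrr mulr0; have := b0 j; lra.
  by rewrite /c divfK// subr_eq0 eq_sym.
exists (fun j => if j == i then B0 else B j); split.
- by move=> j; case: ifP.
- by move=> j; case: ifP => // _ x /BD[].
- move=> j k x; rewrite !inE; case: (eqVneq j i) => [->|ji]; case: (eqVneq k i) => [->|ki]//=.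
  + by move=> _ ks B0x /BD[].
  + by move=> js _ /BD[].
  exact: dB.
move=> j; rewrite inE; case: (eqVneq j i) => [->|ji]/= js.
  by split => //; rewrite (le_trans TB0)//; lra.
have [muB TB] := hB _ js; have [cbj cj1] := cb _ js.
split; first by rewrite muB mu01D// muB0 -cbj; ring.
(* From b j = c j (1 - b i) and 1_(A \ B0) = 1_A - 1_B0: the deviation in A combines that of B0 in A
   with that of B j in the rest. *)
have -> : dev (b j) A (B j) =
    (fun x => (- c j)%:C%C * dev (b i) A B0 x + dev (c j) (A `\` B0) (B j) x).
  apply/funext => x; rewrite /dev -cbj rmorphM rmorphB rmorphN rmorph1/=.
  have -> : \1_(A `\` B0) x = \1_A x - \1_B0 x :> C.
    rewrite !indicE; case: (boolP (x \in B0)) => [|/negP]; rewrite ?inE => xB.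
      by rewrite memNset ?mem_set ?subrr//; [exact: B0A|case].
    rewrite subr0; case: (boolP (x \in A)) => [|/negP]; rewrite ?inE => xA.
      by rewrite mem_set.
    by rewrite memNset//; case.
  ring.
rewrite (le_trans (nrmT_lin _ (inLp_dev _ mA mB0) (inLp_dev _ mD (mB j))))//.
rewrite cabs_real normrN ger0_norm//.
have := nrm_ge0 p (T (dev (b i) A B0)); have := c0 j; nra.
Qed.

End op.

(** * The inequality for narrow operators *)

Section main.
Variable R : realType.
Local Notation C := (R[i]).
Local Notation lam := (@lebesgue_measure R).
Local Notation I01 := ([set` `[0%R, 1%R]] : set R).
Variable p : R.
Hypothesis p1 : 1 <= p.
Let p0 : 0 < p. Proof. exact: lt_le_trans ltr01 p1. Qed.

Lemma sum_mu01_cover (J : finType) (D : J -> set R) :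
  (forall j, measurable (D j)) -> (forall j, D j `<=` I01) -> disjointed D ->
  (forall x, I01 x -> exists j, D j x) -> \sum_j mu01 (D j) = 1.
Proof.
move=> mD DI dD cD; apply: EFin_inj.
rewrite (eq_bigr (fun j => 1 * mu01 (D j))); last by move=> j _; rewrite mul1r.
rewrite -integral_sum_indic//.
transitivity (\int[lam]_(x in I01) (cst 1%E) x)%E.
  apply: eq_integral => x; rewrite inE => Ix; have [j Dj] := cD _ Ix.
  by rewrite (@sum_indic_in _ _ _ _ _ j).
by rewrite integral_cst//= mul1e lam_I01.
Qed.

(** Young's inequality with second factor 1. Averaged over a probability space it bounds the mean on
    the unit ball. At p = 1 the conjugate exponent is infinite, hence the separate case. *)
Lemma young_powR (y : R) : 0 <= y -> y <= y `^ p / p + (1 - p^-1).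
Proof.
move=> y0; have [pe|pn] := eqVneq p 1.
  by rewrite pe invr1 powRr1// mulr1 subrr addr0.
have p1' : 1 < p by rewrite lt_neqAle eq_sym pn.
have q0 : 0 < 1 - p^-1 by rewrite subr_gt0 invf_lt1.
have := @conjugate_powR R y 1 p (1 - p^-1)^-1 y0 ler01 p0.
rewrite invr_gt0 invrK powR1 mulr1 mul1r; apply => //; lra.
Qed.

Lemma cint01_simple_le1 (J : finType) (c : J -> C) (D : J -> set R) :
  (forall j, measurable (D j)) -> (forall j, D j `<=` I01) -> disjointed D ->
  (forall x, I01 x -> exists j, D j x) -> nrm p (simple c D) <= 1 ->
  cabs (cint01 (simple c D)) <= 1.
Proof.
move=> mD DI dD cD n1; rewrite cint01_simple// (le_trans (cabs_sum _ _))//.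
have nE := nrm_simple p1 c mD DI dD.
have n1' : nrm p (simple c D) `^ p <= 1.
  have pw1 : (1 : R) `^ p = 1 by rewrite powR1.
  by rewrite -[leRHS]pw1 ge0_ler_powR ?nnegrE ?nrm_ge0// ltW.
apply: (@le_trans _ _ (\sum_j (cabs (c j) `^ p / p + (1 - p^-1)) * mu01 (D j))).
  apply: ler_sum => j _; rewrite cabsM cabs_real ger0_norm ?mu01_ge0//.
  by rewrite ler_wpM2r ?mu01_ge0// young_powR// cabs_ge0.
rewrite (eq_bigr (fun j => p^-1 * (cabs (c j) `^ p * mu01 (D j)) + (1 - p^-1) * mu01 (D j))).
  rewrite big_split/= -!mulr_sumr -nE sum_mu01_cover// mulr1.
  have : p^-1 * nrm p (simple c D) `^ p <= p^-1 by rewrite ler_piMr// invr_ge0 ltW.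
  lra.
by move=> j _; ring.
Qed.

Variable T : (R -> C) -> (R -> C).
Hypothesis bT : bounded_op p T.

Lemma ae01_T_sub a f g : inLp p f -> inLp p g ->
  ae01 (fun x => T g x - a * T f x) (T (fun x => g x - a * f x)).
Proof.
move=> Lf Lg.
have Lgf : inLp p (fun x => g x - a * f x) by apply: inLpB => //; exact: inLpZ.
(* Linearity is applied to g = a f + (g - a f). *)
have := ae_T_lin bT a Lf Lgf.
rewrite (_ : (fun x => a * f x + _) = g); last by apply/funext => x; ring.
apply: (@filterS _ _ (ae_filter_ringOfSetsType lam)) => x h Ix.
by rewrite h//; ring.
Qed.

Lemma nrmT_sub a f g : inLp p f -> inLp p g ->
  nrm p (fun x => T g x - a * T f x) = nrm p (T (fun x => g x - a * f x)).
Proof.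
move=> Lf Lg; have LT := inLpT bT; apply: nrm_ae; last exact: ae01_T_sub.
- by apply: inLpB => //; [exact: LT|apply: inLpZ => //; exact: LT].
- by apply: LT; apply: inLpB => //; exact: inLpZ.
Qed.

Hypothesis nT : narrow p T.

(** * The inequality for simple functions *)

Section simple_case.
Variables (I J : finType) (a : I -> C) (A : I -> set R) (c : J -> C) (D : J -> set R).
Hypothesis mA : forall i, measurable (A i).
Hypothesis AI : forall i, A i `<=` I01.
Hypothesis dA : disjointed A.
Hypothesis mD : forall j, measurable (D j).
Hypothesis DI : forall j, D j `<=` I01.
Hypothesis dD : disjointed D.
Hypothesis cD : forall x, I01 x -> exists j, D j x.

(** Each A i is cut in the ratios |D j|, which sum to 1; pieces of different A i are disjoint
    because the A i are. *)
Lemma tensor_sets e : 0 < e -> exists B : I * J -> set R,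
  [/\ forall k, measurable (B k), forall k, B k `<=` A k.1, disjointed B,
      forall k, mu01 (B k) = mu01 (A k.1) * mu01 (D k.2) &
      forall k, nrm p (T (dev (mu01 (D k.2)) (A k.1) (B k))) <= e].
Proof.
move=> e0.
have sD : \sum_j mu01 (D j) <= 1 by rewrite sum_mu01_cover.
have /choice[B hB] : forall i, exists Bi : J -> set R,
  [/\ forall j, measurable (Bi j), forall j, Bi j `<=` A i,
      forall j k x, j \in index_enum J -> k \in index_enum J -> Bi j x -> Bi k x -> j = k &
      forall j, j \in index_enum J -> mu01 (Bi j) = mu01 (D j) * mu01 (A i) /\
        nrm p (T (dev (mu01 (D j)) (A i) (Bi j))) <= e].
  by move=> i; apply: partition_set => //; [exact: index_enum_uniq|move=> j; exact: mu01_ge0].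
exists (fun k => B k.1 k.2); split.
- by move=> k; have [] := hB k.1.
- by move=> k; have [] := hB k.1.
- move=> [i j] [i' j'] x /= Bx Bx'.
  have ii' : i = i'.
    have [_ h _ _] := hB i; have [_ h' _ _] := hB i'.
    exact: (dA (h _ _ Bx) (h' _ _ Bx')).
  subst i'; congr (_, _); have [_ _ h _] := hB i.
  by apply: (h _ _ x); rewrite ?mem_index_enum.
- move=> k; have [_ _ _ h] := hB k.1; have [h1 _] := h k.2 (mem_index_enum _).
  by rewrite h1 mulrC.
- by move=> k; have [_ _ _ h] := hB k.1; have [] := h k.2 (mem_index_enum _).
Qed.

(** The measures of the pieces factor, hence so do p-th powers of norms. The coefficients d are
    arbitrary because both c and c - gamma m are needed. *)
Lemma nrm_tensor (d : J -> C) (B : I * J -> set R) :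
  (forall k, measurable (B k)) -> (forall k, B k `<=` A k.1) -> disjointed B ->
  (forall k, mu01 (B k) = mu01 (A k.1) * mu01 (D k.2)) ->
  nrm p (simple (fun k => a k.1 * d k.2) B) = nrm p (simple a A) * nrm p (simple d D).
Proof.
move=> mB BA dB muB; have p_neq0 : p != 0 by rewrite gt_eqF.
have BI k : B k `<=` I01 by apply: subset_trans (BA k) _.
rewrite -[LHS]powRr1 ?nrm_ge0// -[RHS]powRr1 ?mulr_ge0 ?nrm_ge0//.
rewrite -(mulfV p_neq0) !powRrM powRM ?nrm_ge0//; congr (_ `^ _).
rewrite !nrm_simple// big_distrlr/= pair_big/=.
by apply: eq_bigr => k _; rewrite cabsM powRM ?cabs_ge0// muB; ring.
Qed.

(** The factor [nrm p (simple a A)] on the left remains because an approximant of a unit vector need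
    not have norm 1. *)
Lemma simple_ineq (gamma : C) (N : R) :
  (forall w, inLp p w -> nrm p w <= 1 -> nrm p (fun x => w x - T w x) <= N) ->
  nrm p (simple a A) <= 1 -> nrm p (simple c D) <= 1 ->
  nrm p (fun x => simple c D x - gamma * cint01 (simple c D)) * nrm p (simple a A)
    <= N + nrm p (fun x => gamma * simple a A x - T (simple a A) x).
Proof.
move=> hN ua fc; set u := simple a A; set f := simple c D.
set m := cint01 f.
have m1 : cabs m <= 1 by exact: cint01_simple_le1.
have Lu : inLp p u by exact: inLp_simple.
apply/ler_addgt0Pr => e e0.
set S := \sum_(k : I * J) cabs (a k.1 * c k.2).
have S0 : 0 <= S by apply: sumr_ge0 => k _; exact: cabs_ge0.
(* The total error is S e / (S + 1) <= e; adding 1 covers the case S = 0. *)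
have e'0 : 0 < e / (S + 1) by rewrite divr_gt0//; lra.
have [B [mB BA dB muB TB]] := tensor_sets e'0.
set w := simple (fun k => a k.1 * c k.2) B.
have Lw : inLp p w by exact: inLp_simple.
have w1 : nrm p w <= 1.
  by rewrite nrm_tensor// -[leRHS]mulr1 ler_pM ?nrm_ge0.
set v := simple (fun k => a k.1 * (c k.2 - gamma * m)) B.
have Lv : inLp p v by exact: inLp_simple.
have fE x : I01 x -> f x - gamma * m = simple (fun j => c j - gamma * m) D x.
  move=> Ix; have [j Dj] := cD Ix.
  by rewrite /f /simple !(@sum_indic_in _ _ _ _ _ j).
have vE : nrm p v = nrm p (fun x => f x - gamma * m) * nrm p u.
  rewrite mulrC /v (nrm_tensor (fun j => c j - gamma * m))//; congr (_ * _).
  by rewrite /nrm (eq_Lpnorm01 _ fE).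
have Lwm : inLp p (fun x => w x - m * u x) by apply: inLpB => //; exact: inLpZ.
have Twm : nrm p (T (fun x => w x - m * u x)) <= e.
  (* Expanding m as the sum of the c_j |D j| turns m u into a double sum, which matches w term by
     term. *)
  have -> : (fun x => w x - m * u x) =
      (fun x => \sum_(k : I * J) (a k.1 * c k.2) * dev (mu01 (D k.2)) (A k.1) (B k) x).
    apply/funext => x; under eq_bigr do rewrite /dev mulrBr.
    rewrite sumrB; congr (_ - _); rewrite /m /f cint01_simple// mulrC /u /simple.
    rewrite big_distrlr/= pair_big/=; apply: eq_bigr => k _; ring.
  rewrite (le_trans (nrmT_sum p1 bT _ _ _))//; first by move=> k; exact: inLp_dev.
  apply: (@le_trans _ _ (\sum_(k : I * J) cabs (a k.1 * c k.2) * (e / (S + 1)))).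
    by apply: ler_sum => k _; rewrite ler_wpM2l ?cabs_ge0.
  rewrite -mulr_suml -/S mulrCA ler_piMr ?(ltW e0)// ler_pdivrMr; lra.
have LT := inLpT bT.
(* Equality holds on the pieces B k; elsewhere v is 0, whatever u is there. *)
have vw x : I01 x -> cabs (v x) <= cabs (w x - gamma * m * u x).
  move=> Ix; have [[k Bk]|nB] := pselect (exists k, B k x); last first.
    by rewrite /v /simple sum_indic_out// cabs0 cabs_ge0.
  rewrite /v /w /u /simple !(@sum_indic_in _ _ _ _ _ k)//.
  rewrite (@sum_indic_in _ _ _ _ _ k.1)//; last exact: BA.
  by rewrite le_eqVlt; apply/orP; left; apply/eqP; congr cabs; ring.
have Lwg : inLp p (fun x => w x - gamma * m * u x) by apply: inLpB => //; exact: inLpZ.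
rewrite -vE (le_trans (nrm_le p1 Lv Lwg vw))//.
have Lgu : inLp p (fun x => gamma * u x - T u x).
  by apply: inLpB => //; [exact: inLpZ|exact: LT].
have LwT : inLp p (fun x => w x - T w x) by apply: inLpB => //; exact: LT.
have LTT : inLp p (fun x => T w x - m * T u x).
  by apply: inLpB => //; [exact: LT|apply: inLpZ => //; exact: LT].
have -> : (fun x => w x - gamma * m * u x) =
    (fun x => ((w x - T w x) + (- m) * (gamma * u x - T u x)) + (T w x - m * T u x)).
  by apply/funext => x; ring.
have Lmgu := inLpZ p1 (- m) Lgu.
rewrite (le_trans (nrmD p1 (inLpD p1 LwT Lmgu) LTT))//.
rewrite lerD//; last by rewrite nrmT_sub.
rewrite (le_trans (nrmD p1 LwT Lmgu))// lerD ?hN//.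
by rewrite nrmZ// cabsN ler_piMl// nrm_ge0.
Qed.

End simple_case.

(** * Passage from simple functions to L^p and to operator norms *)

Lemma nrm_cst_le (a : C) : nrm p (fun _ : R => a) <= cabs a.
Proof.
have LI : inLp p (\1_I01 : R -> C) by exact: inLp_indic.
have -> : nrm p (fun _ : R => a) = nrm p (fun x => a * \1_I01 x).
  rewrite /nrm; congr fine; apply: eq_Lpnorm01 => // x Ix.
  by rewrite indicE mem_set// mulr1.
rewrite nrmZ// nrm_indic// ler_piMr ?cabs_ge0//.
by rewrite /mu01 lam_I01/= powR1.
Qed.

Lemma narrow_ineq (gamma : C) (N : R) (f u : R -> C) :
  (forall w, inLp p w -> nrm p w <= 1 -> nrm p (fun x => w x - T w x) <= N) ->
  inLp p f -> nrm p f <= 1 -> inLp p u -> nrm p u = 1 ->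
  nrm p (fun x => f x - gamma * cint01 f)
    <= N + nrm p (fun x => gamma * u x - T u x).
Proof.
move=> hN Lf f1 Lu u1; have [M M0 hM] := nrmT_bound bT; have LT := inLpT bT.
set X := nrm p _; set Y := nrm p _; set g := cabs gamma.
have g0 : 0 <= g by exact: cabs_ge0.
have X0 : 0 <= X by exact: nrm_ge0.
(* K collects the first-order errors: g + M from replacing u in Y, 1 + g from replacing f in X, and
   X + (1 + g) from the norm of u' being only at least 1 - e. The last one uses e <= 1. K may
   contain X, which is a fixed real number. *)
set K := g + M + X + 2 * (1 + g).
have K0 : 0 < K + 1 by rewrite /K; lra.
suff H e : 0 < e -> e <= 1 -> X <= N + Y + e * K.
  apply/ler_addgt0Pr => e e0.
  set d := Num.min 1 (e / (K + 1)).
  have d0 : 0 < d by rewrite lt_min ltr01/= divr_gt0.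
  have d1 : d <= 1 by rewrite ge_min lexx.
  have dK : d * (K + 1) <= e by rewrite -ler_pdivlMr// ge_min lexx orbT.
  by rewrite (le_trans (H d d0 d1))// lerD2l; nra.
move=> e0 e1.
have [J [c [D [[mD DI dD cD] fD nD ED]]]] := simple_approx p1 Lf e0.
have [I [a [A [[mA AI dA _] uA nA _]]]] := simple_approx p1 Lu e0.
set f' := simple c D in fD nD ED; set u' := simple a A in uA nA.
have Lf' : inLp p f' by exact: inLp_simple.
have Lu' : inLp p u' by exact: inLp_simple.
have f'1 : nrm p f' <= 1 by rewrite (le_trans (nrm_le p1 Lf' Lf fD)).
have u'1 : nrm p u' <= 1 by rewrite (le_trans (nrm_le p1 Lu' Lu uA)) ?u1.
have main := simple_ineq mA AI dA mD DI dD cD gamma hN u'1 f'1.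
rewrite -/f' -/u' in main.
have Lc (b : C) : inLp p (fun _ : R => b) by exact: inLp_cst.
have Lff : inLp p (fun x => f x - f' x) by exact: inLpB.
have Luu : inLp p (fun x => u x - u' x) by exact: inLpB.
have ue : 1 - e <= nrm p u'.
  have := nrmD p1 Luu Lu'.
  rewrite (_ : (fun x => u x - u' x + u' x) = u) ?u1; last by apply/funext => x; rewrite subrK.
  move: nA; lra.
have LX : inLp p (fun x => f x - gamma * cint01 f) by apply: inLpB.
have LX' : inLp p (fun x => f' x - gamma * cint01 f') by apply: inLpB.
set X' := nrm p (fun x => f' x - _) in main.
have X'0 : 0 <= X' by exact: nrm_ge0.
have LE : inLp p (fun x => (f x - f' x) + - gamma * (cint01 f - cint01 f')) by apply: inLpD.
have nE : nrm p (fun x => (f x - f' x) + - gamma * (cint01 f - cint01 f')) <= e * (1 + g).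
  rewrite (le_trans (nrmD p1 Lff (Lc _)))// (le_trans (lerD (ltW nD) (nrm_cst_le _)))//.
  by rewrite cabsM cabsN mulrDr mulr1 lerD2l mulrC ler_wpM2r// ltW.
have XX' : X <= e * (1 + g) + X'.
  rewrite /X (_ : (fun x => f x - _) = (fun x => ((f x - f' x) + - gamma * (cint01 f - cint01 f'))
     + (f' x - gamma * cint01 f'))); last by apply/funext => x; ring.
  by rewrite (le_trans (nrmD p1 LE LX'))// lerD2r.
have X'X : X' <= X + e * (1 + g).
  rewrite /X' (_ : (fun x => f' x - _) = (fun x => (f x - gamma * cint01 f) -
    ((f x - f' x) + - gamma * (cint01 f - cint01 f')))); last by apply/funext => x; ring.
  by rewrite (le_trans (nrmB p1 LX LE))// lerD2l.
have YY' : nrm p (fun x => gamma * u' x - T u' x) <= Y + (g + M) * e.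
  have LY : inLp p (fun x => gamma * u x - T u x).
    by apply: inLpB => //; [exact: inLpZ|exact: LT].
  (* The factor 1 gives the difference the shape required by [nrmT_sub]. *)
  have LTT : inLp p (fun x => T u x - 1 * T u' x).
    by apply: inLpB => //; [exact: LT|apply: inLpZ => //; exact: LT].
  have Lg := inLpZ p1 (- gamma) Luu.
  rewrite (_ : (fun x => gamma * u' x - _) = (fun x => ((gamma * u x - T u x) +
    - gamma * (u x - u' x)) + (T u x - 1 * T u' x))); last by apply/funext => x; ring.
  rewrite (le_trans (nrmD p1 (inLpD p1 LY Lg) LTT))// mulrDl addrA lerD//.
    rewrite (le_trans (nrmD p1 LY Lg))// lerD2l nrmZ// cabsN ler_wpM2l// ltW//.
  rewrite nrmT_sub// (_ : (fun x => u x - 1 * u' x) = (fun x => u x - u' x)).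
    by rewrite (le_trans (hM _ Luu))// ler_wpM2l// ltW.
  by apply/funext => x; rewrite mul1r.
have XN : X' * (1 - e) <= N + Y + (g + M) * e.
  rewrite -addrA; apply: le_trans (_ : X' * nrm p u' <= _); first by rewrite ler_wpM2l.
  by rewrite (le_trans main)// lerD2l.
have h1 : X' * e <= (X + (1 + g)) * e.
  rewrite ler_wpM2r ?(ltW e0)// (le_trans X'X)// lerD2l ler_piMl// addr_ge0//.
rewrite /K; nra.
Qed.

Lemma opnorm_ub S f : inLp p f -> nrm p f <= 1 -> (Lpnorm p (S f) <= opnorm p S)%E.
Proof.
by move=> Lf f1; apply: ereal_sup_ubound; exists f => //; split => //; rewrite nrmE// lee_fin.
Qed.

Lemma opnorm_ge0 S : (0 <= opnorm p S)%E.
Proof.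
have L0 : inLp p (fun _ : R => 0 : C) by exact: inLp_cst.
apply: (@le_trans _ _ (Lpnorm p (S (fun _ => 0)))); first exact: Lpnorm_ge0.
by apply: opnorm_ub => //; rewrite nrm0 ?ler01.
Qed.

Lemma lower_bound_ge0 S : (0 <= lower_bound p S :> \bar R)%E.
Proof. by apply: le_ereal_inf_tmp => _ [u _ <-]; exact: Lpnorm_ge0. Qed.

Lemma narrow_opnorm (gamma : C) :
  (opnorm p (op_sub (@Iop R) (op_scale gamma (@Eop R))) <=
   opnorm p (op_sub (@Iop R) T) + lower_bound p (op_sub (op_scale gamma (@Iop R)) T))%E.
Proof.
have LT := inLpT bT.
apply: ge_ereal_sup => _ [f [Lf f1] <-].
have := opnorm_ge0 (op_sub (@Iop R) T).
(* If this norm is +oo the sum is +oo, because the other summand is nonnegative and so not -oo. If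
   it is real, it moves to the left and each u can be treated alone. *)
case E : (opnorm p (op_sub (@Iop R) T)) => [N| |] // N0; last first.
  rewrite addye ?leey//; apply/eqP => h.
  by have := lower_bound_ge0 (op_sub (op_scale gamma (@Iop R)) T); rewrite h.
have Lfg : inLp p (fun x => f x - gamma * cint01 f) by apply: inLpB => //; exact: inLp_cst.
rewrite /op_sub /op_scale /Iop /Eop nrmE// -leeBlDl//.
apply: le_ereal_inf_tmp => _ [u [Lu u1] <-].
have Lgu : inLp p (fun x => gamma * u x - T u x).
  by apply: inLpB => //; [exact: inLpZ|exact: LT].
rewrite nrmE// -EFinB lee_fin lerBlDl narrow_ineq//.
- move=> w Lw w1; rewrite -lee_fin -E -nrmE; last by apply: inLpB => //; exact: LT.
  exact: (opnorm_ub _ Lw w1).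
- by rewrite -lee_fin -nrmE.
- by rewrite /nrm u1.
Qed.

End main.

(** * The lower bound C_p *)

Section two_valued.
Variable R : realType.
Local Notation C := (R[i]).
Local Notation lam := (@lebesgue_measure R).
Local Notation I01 := ([set` `[0%R, 1%R]] : set R).
Variable p : R.
Hypothesis p1 : 1 <= p.
Let p0 : 0 < p. Proof. exact: lt_le_trans ltr01 p1. Qed.

Definition halves (t : R) (b : bool) : set R := if b then [set` `[0, t]] else [set` `]t, 1]].

Definition two_valued (t x y : R) : R -> C :=
  simple (fun b : bool => (if b then x else - y)%:C%C) (halves t).

(** The test function is x on [0,t] and -y on ]t,1], with mean t x - (1 - t) y. Subtracting the mean
    leaves (1 - t)(x + y) and -t (x + y). *)
Lemma opnorm_two_valued (t x y : R) : 0 <= t <= 1 -> 0 <= x -> 0 <= y ->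
  t * x `^ p + (1 - t) * y `^ p <= 1 ->
  (((t * ((1 - t) * (x + y)) `^ p + (1 - t) * (t * (x + y)) `^ p) `^ p^-1)%:E <=
   opnorm p (op_sub (@Iop R) (op_scale 1%R (@Eop R))))%E.
Proof.
move=> /andP[t0 t1] x0 y0 txy.
have mH b : measurable (halves t b) by case: b => /=; exact: measurable_itv.
have HI b : halves t b `<=` I01.
  case: b => z /=; rewrite !in_itv/= => /andP[h1 h2]; apply/andP; split => //.
  - by rewrite (le_trans h2).
  - by rewrite (le_trans t0)// ltW.
have dH : disjointed (halves t).
  by move=> [] [] z//=; rewrite !in_itv/= => /andP[h1 h2] /andP[h3 h4]; lra.
have cH z : I01 z -> exists b, halves t b z.
  rewrite /= in_itv/= => /andP[z0 z1]; have [zt|tz] := leP z t.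
    by exists true; rewrite /= in_itv/= z0.
  by exists false; rewrite /= in_itv/= tz.
have muT : mu01 (halves t true) = t.
  rewrite /mu01 /= lebesgue_measure_itv/= lte_fin; case: ltP => h /=; first by rewrite subr0.
  by apply/eqP; rewrite eq_le t0 h.
have muF : mu01 (halves t false) = 1 - t.
  rewrite /mu01 /= lebesgue_measure_itv/= lte_fin; case: ltP => h //=.
  by apply/eqP; rewrite eq_sym subr_eq0 eq_le t1 h.
set f := two_valued t x y.
have Lf : inLp p f by exact: inLp_simple.
have f1 : nrm p f <= 1.
  rewrite leNgt; apply/negP => h.
  have : 1 `^ p < nrm p f `^ p by rewrite gt0_ltr_powR ?nnegrE ?nrm_ge0.
  rewrite powR1 /f /two_valued nrm_simple// big_bool/= muT muF !cabs_real normrN !ger0_norm//.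
  by rewrite ltNge mulrC [X in _ + X]mulrC txy.
apply: le_trans (opnorm_ub _ Lf f1).
have Ef : cint01 f = (t * x - (1 - t) * y)%:C%C.
  by rewrite cint01_simple// big_bool/= muT muF -!rmorphM -rmorphD; congr (_%:C)%C; ring.
pose g : R -> C := simple
  (fun b : bool => (if b then (1 - t) * (x + y) else - (t * (x + y)))%:C%C) (halves t).
have Lg : inLp p g by exact: inLp_simple.
rewrite (@eq_Lpnorm01 _ _ _ g); last first.
  move=> z Iz; have [b Hb] := cH _ Iz.
  rewrite /op_sub /Iop /op_scale /Eop mul1r Ef /g /f /two_valued /simple.
  rewrite !(@sum_indic_in _ _ _ _ _ b)// -rmorphB; congr (_%:C)%C.
  by case: b {Hb}; ring.
have p_neq0 : p != 0 by rewrite gt_eqF.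
have t1' : 0 <= 1 - t by lra.
have xy0 : 0 <= x + y by rewrite addr_ge0.
have -> : Lpnorm p g = ((nrm p g `^ p) `^ p^-1)%:E.
  by rewrite nrmE// -powRrM mulfV// powRr1 ?nrm_ge0.
rewrite lee_fin /g nrm_simple// big_bool/= muT muF !cabs_real normrN !ger0_norm ?mulr_ge0//.
by rewrite mulrC [X in _ + X]mulrC.
Qed.

(** Unit mass concentrated on [0, e/2], that is x = 2/e and y = 0, gives 2 (1 - e/2) = 2 - e. *)
Lemma Cp1_le : p = 1 -> (2%:E <= opnorm p (op_sub (@Iop R) (op_scale 1%R (@Eop R))))%E.
Proof.
move=> pe; apply/lee_subgt0Pr => e e0.
have [e2|e2] := leP 2 e.
  by rewrite (le_trans _ (opnorm_ge0 p1 _))// -EFinB lee_fin subr_le0.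
have t0 : 0 < e / 2 by rewrite divr_gt0.
have t01 : 0 <= e / 2 <= 1 by lra.
have x0 : 0 <= (e / 2)^-1 by rewrite invr_ge0 ltW.
apply: le_trans (opnorm_two_valued t01 x0 (lexx 0) _).
  have t1' : 0 <= 1 - e / 2 by lra.
  have E : e / 2 * (e / 2)^-1 = 1 by rewrite divff// gt_eqF.
  rewrite -EFinB lee_fin pe addr0 E (powRr1 ler01) mulr1.
  rewrite (@powRr1 _ (_ * _)) ?mulr_ge0// mulrCA E mulr1 invr1 powRr1; lra.
rewrite pe !powRr1// mulr0 addr0 divff// gt_eqF//.
Qed.

(** With t = a fixed, the bound for two-valued functions grows with x + y, which is maximized under
    a x^p + (1 - a) y^p = 1; the maximum is the stated term. *)
Lemma Cp_term_le (a : R) : 1 < p -> 0 <= a <= 1 ->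
  ((((a `^ (p - 1) + (1 - a) `^ (p - 1)) `^ p^-1 *
    (a `^ (p - 1)^-1 + (1 - a) `^ (p - 1)^-1) `^ (1 - p^-1))%R)%:E <=
   opnorm p (op_sub (@Iop R) (op_scale 1%R (@Eop R))))%E.
Proof.
move=> p1' /andP[a0 a1].
have q0 : 0 < p - 1 by lra.
have r0 : 0 < (p - 1)^-1 by rewrite invr_gt0.
have p_neq0 : p != 0 by rewrite gt_eqF.
set r := (p - 1)^-1 in r0 *.
have [ae|a_int] : (a = 0 \/ a = 1) \/ 0 < a < 1.
  have [->|an0] := eqVneq a 0; first by left; left.
  have [->|an1] := eqVneq a 1; first by left; right.
  by right; rewrite !lt_neqAle eq_sym an0 an1 a0.
  (* At [a = 0] and [a = 1] the value is 1, attained by a mean zero sign. *)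
  have h01 : 0 <= (2^-1 : R) <= 1 by rewrite invr_ge0 ler0n invf_le1// ler1n.
  have := opnorm_two_valued h01 ler01 ler01; rewrite !powR1 => /(_ _).
  have -> : (1 - 2^-1) * (1 + 1) = 1 :> R by lra.
  have -> : 2^-1 * (1 + 1) = 1 :> R by lra.
  rewrite !powR1 !mulr1 (_ : 2^-1 + (1 - 2^-1) = 1); last by lra.
  rewrite powR1 => h; apply: le_trans (h (lexx _)); rewrite lee_fin.
  by case: ae => ->; rewrite ?subrr ?subr0 !powR1 !powR0 ?gt_eqF// ?addr0 ?add0r !powR1 mulr1.
have /andP[{}a0 {}a1] := a_int; have b0 : 0 < 1 - a by lra.
set b := 1 - a in b0 *.
(* The values [c / u] and [- c / v] realize equality in Hoelder's inequality. *)
set u := a `^ r; set v := b `^ r.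
have u0 : 0 < u by rewrite powR_gt0.
have v0 : 0 < v by rewrite powR_gt0.
set S := u^-1 + v^-1.
have S0 : 0 < S by rewrite addr_gt0 ?invr_gt0.
(* Normalization: a (c/u)^p + b (c/v)^p = c^p S = 1. *)
set c := S `^ (- p^-1).
have c0 : 0 < c by rewrite powR_gt0.
have cp : c `^ p = S^-1 by rewrite -powRrM mulNr mulVf// powR_inv1 ?ltW.
have rp : r * p = 1 + r.
  by rewrite -{1}(subrK 1 p) mulrDr mulr1 mulVf// gt_eqF.
have powVp (z : R) : 0 < z -> z * (z `^ r)^-1 `^ p = (z `^ r)^-1.
  move=> z0; have w0 : 0 < z `^ r by rewrite powR_gt0.
  have E : (z `^ r) `^ p = z * z `^ r.
    by rewrite -powRrM rp powRD ?powRr1 ?ltW// (gt_eqF z0) implybT.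
  have : ((z `^ r)^-1 * z `^ r) `^ p = 1 by rewrite mulVf ?powR1// gt_eqF.
  rewrite powRM ?invr_ge0 ?(ltW w0)// E mulrA => h.
  have wn0 : z `^ r != 0 by rewrite gt_eqF.
  by apply: (mulIf wn0); rewrite mulVf// -h [z * _]mulrC.
have up : a * u^-1 `^ p = u^-1 by exact: powVp.
have vp : b * v^-1 `^ p = v^-1 by exact: powVp.
have x0 : 0 <= c * u^-1 by rewrite ltW// mulr_gt0 ?invr_gt0.
have y0 : 0 <= c * v^-1 by rewrite ltW// mulr_gt0 ?invr_gt0.
have a01 : 0 <= a <= 1 by rewrite !ltW.
have := opnorm_two_valued a01 x0 y0; rewrite -/b => H.
apply: le_trans (H _); last first.
  rewrite !powRM ?invr_ge0 ?(ltW c0) ?(ltW u0) ?(ltW v0)// cp mulrCA up mulrCA vp.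
  by rewrite -mulrDr mulVf// gt_eqF.
rewrite -mulrDr -/S lee_fin.
have root (z : R) : 0 < z -> (z `^ r) `^ (p - 1) = z.
  by move=> z0; rewrite -powRrM mulVf ?powRr1 ?ltW// gt_eqF.
have Suv : S * (u * v) = u + v by rewrite /S; field; rewrite !gt_eqF.
(* By u^(p-1) = a, v^(p-1) = b and S u v = u + v. *)
have Sab : S `^ (p - 1) * (a * b) = (u + v) `^ (p - 1).
  rewrite -Suv powRM ?mulr_ge0 ?(ltW S0) ?(ltW u0) ?(ltW v0)//; congr (_ * _).
  by rewrite powRM ?(ltW u0) ?(ltW v0)// !root.
have cS : (c * S) `^ p = S `^ (p - 1).
  rewrite powRM ?(ltW c0) ?(ltW S0)// cp -(mulr_powRB1 (ltW S0) p0) mulrA mulVf ?mul1r//.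
  by rewrite gt_eqF.
have cS0 : 0 <= c * S by rewrite ltW// mulr_gt0.
rewrite !(powRM _ _ cS0) ?(ltW a0) ?(ltW b0)// cS.
rewrite -(mulr_powRB1 (ltW a0) p0) -(mulr_powRB1 (ltW b0) p0).
rewrite (_ : _ + _ * _ = (a `^ (p - 1) + b `^ (p - 1)) * (u + v) `^ (p - 1)); last first.
  by rewrite -Sab; ring.
rewrite [leRHS]powRM ?addr_ge0 ?powR_ge0// -powRrM mulrBl mul1r mulfV//.
Qed.

Lemma Cp_le : ((Cp p)%:E <= opnorm p (op_sub (@Iop R) (op_scale 1%R (@Eop R))))%E.
Proof.
rewrite /Cp; case: eqVneq => [/Cp1_le//|pn1].
have p1' : 1 < p by rewrite lt_neqAle eq_sym pn1.
have := opnorm_ge0 p1 (op_sub (@Iop R) (op_scale 1%R (@Eop R))).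
(* A real supremum is compared with a real bound N; an infinite norm makes the claim trivial. *)
case E : (opnorm p _) => [N| |] // _; last exact: leey.
rewrite lee_fin; apply: ge_sup.
  by eexists; exists 0; [rewrite /= in_itv/= lexx ler01|reflexivity].
move=> _ [a /= a01 <-]; rewrite -lee_fin -E; exact: Cp_term_le.
Qed.

End two_valued.

Theorem theorem1p3 (R : realType) (p : R) (T : (R -> R[i]) -> (R -> R[i])) :
  1 <= p -> bounded_op p T -> narrow p T ->
  (forall gamma : R[i],
     (opnorm p (op_sub (@Iop R) T) + lower_bound p (op_sub (op_scale gamma (@Iop R)) T)
      >= opnorm p (op_sub (@Iop R) (op_scale gamma (@Eop R))))%E) /\
  (opnorm p (op_sub (@Iop R) T) + lower_bound p (op_sub (@Iop R) T) >= (Cp p)%:E)%E.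
Proof.
move=> p1 bT nT; have h := narrow_opnorm p1 bT nT; split => //.
rewrite (le_trans (Cp_le p1))// (le_trans (h 1))//.
suff -> : op_scale 1 (@Iop R) = @Iop R by [].
by apply/funext => f; apply/funext => x; rewrite /op_scale mul1r.
Qed.
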